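(* Let $\theta>0$, let $X=\{X_t,t\ge 0\}$ be the Ornstein-Uhlenbeck process solving $X_0=0$, $dX_t=-\theta X_t\,dt+dW_t$, $t\ge 0$, where $W$ is a standard Brownian motion, and let $(\Delta_n)_{n\ge1}$ be a deterministic sequence of positive numbers with $\Delta_n\to0$ and $T:=n\Delta_n\to\infty$ as $n\to\infty$. With $t_i=i\Delta_n$, $i=0,\dots,n$, set $$\widetilde{\theta}_n:=\frac{1}{\frac{2}{n}\sum_{i=1}^{n}X_{t_i}^2}.$$ Then $\widetilde{\theta}_n$ is a weakly consistent estimator of $\theta$, that is, $\widetilde{\theta}_n\to\theta$ in probability as $n\to\infty$. If, moreover, $n\Delta_n^{\eta}\to0$ for some $1<\eta<2$, or $n\Delta_n^{\eta}\to\infty$ for some $\eta>1$, then $\widetilde{\theta}_n$ is strongly consistent, that is, $\widetilde{\theta}_n\to\theta$ almost surely as $n\to\infty$.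
   Context: Explicitly, $X_t=\int_0^t e^{-\theta(t-s)}\,dW_s$. The number $T=n\Delta_n$ depends on $n$. *)

(* Defs.v *)
From HB Require Import structures.
From mathcomp Require Import all_boot all_order all_algebra.
From mathcomp Require Import all_classical all_reals all_analysis.
Import Order.TTheory GRing.Theory Num.Theory.
Import numFieldNormedType.Exports.

Set Implicit Arguments.
Unset Strict Implicit.
Unset Printing Implicit Defensive.

Local Open Scope classical_set_scope.
Local Open Scope ring_scope.

(* Taking some of the [B i] to be [setT] gives the product rule for every
   subfamily, so the full intersection suffices. *)
Definition mutually_independent (d : measure_display) (Omega : measurableType d)
    (R : realType) (P : probability Omega R) (n : nat)
    (Y : 'I_n -> Omega -> R) : Prop :=
  forall B : 'I_n -> set R, (forall i, measurable (B i)) ->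
    P (\bigcap_(i in [set: 'I_n]) (Y i @^-1` B i)) =
    (\prod_(i < n) P (Y i @^-1` B i))%E.

(* Processes are indexed by all of [R]; only the times [t >= 0] matter. The
   second parameter of [normal_prob] is the standard deviation. *)
Record standard_brownian_motion (d : measure_display)
    (Omega : measurableType d) (R : realType) (P : probability Omega R)
    (W : R -> {RV P >-> R}) : Prop := StandardBrownianMotion {
  bm_start : {ae P, forall w, W 0 w = 0};
  bm_indep : forall (n : nat) (t : nat -> R), 0 <= t 0%N ->
    {homo t : i j / (i <= j)%N >-> i <= j} ->
    mutually_independent P
      (fun i : 'I_n => fun w => W (t i.+1) w - W (t i) w);
  bm_gauss : forall s t : R, 0 <= s -> s < t ->
    forall A : set R, measurable A ->
      P ((fun w => W t w - W s w) @^-1` A) =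
      normal_prob 0 (Num.sqrt (t - s)) A;
  bm_continuous :
    {ae P, forall w, {within `[0, +oo[, continuous (fun t : R => W t w)}}
}.

(* The noise is additive, so the stochastic integral of the constant 1 is the
   increment [W t - W 0], and the equation [dX = - theta X dt + dW] in integral
   form involves only an ordinary integral along each path. *)
Record ornstein_uhlenbeck (d : measure_display) (Omega : measurableType d)
    (R : realType) (P : probability Omega R) (theta : R)
    (W X : R -> {RV P >-> R}) : Prop := OrnsteinUhlenbeck {
  ou_start : {ae P, forall w, X 0 w = 0};
  ou_continuous :
    {ae P, forall w, {within `[0, +oo[, continuous (fun t : R => X t w)}};
  ou_sde : {ae P, forall w, forall t : R, 0 <= t ->
    X t w = X 0 w + \int[lebesgue_measure]_(s in `[0, t]) (- theta * X s w)
            + (W t w - W 0 w)}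
}.

Definition cvg_in_probability (d : measure_display) (Omega : measurableType d)
    (R : realType) (P : probability Omega R) (Y : nat -> Omega -> R) (l : R)
    : Prop :=
  forall eps : R, 0 < eps ->
    P [set w | eps < `|Y n w - l|] @[n --> \oo] --> 0%E.

Definition cvg_almost_surely (d : measure_display) (Omega : measurableType d)
    (R : realType) (P : probability Omega R) (Y : nat -> Omega -> R) (l : R)
    : Prop :=
  {ae P, forall w, Y n w @[n --> \oo] --> l}.

Definition theta_tilde (Omega : Type) (R : realType) (X : R -> Omega -> R)
    (Delta : nat -> R) (n : nat) (w : Omega) : R :=
  1 / (2 / n%:R * \sum_(1 <= i < n.+1) X (i%:R * Delta n) w ^+ 2).

(* Main.v *)
From HB Require Import structures.
Require Import Defs.
From mathcomp Require Import all_boot all_order all_algebra.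
From mathcomp Require Import all_classical all_reals all_analysis.
From mathcomp Require Import measurable_realfun ring lra zify.
Import Order.TTheory GRing.Theory Num.Theory.
Import numFieldNormedType.Exports.
Local Open Scope classical_set_scope.
Local Open Scope ring_scope.

(** Fix a mesh h and let Y be the Euler chain of the equation on the grid h N,
driven by the increments of W. Almost surely the following two facts hold for
all h = 1/(m+1) at once.
- The averages of (W((k+l)h) - W(kh))^2 converge to l h for every l, by a
  second moment bound along the squares and monotonicity of the sums. By
  polarization all lag products of the increments average to 0, and this alone
  forces the averages of Y^2 to converge to h / (1 - (1 - theta h)^2), which
  is 1/(2 theta) + O(h).
- The fourth powers of the dyadic increments of W at all levels below h are
  controlled by their means, by a second moment bound summed over the levels.
  Chaining then bounds the average over blocks of the squared oscillation of W
  by O(h), uniformly over the choice of a point in each block.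
Since the drift is contracting, X stays within these oscillations of Y in mean
square, at all times and hence at the sampling times. The averages of X^2 thus
converge almost surely to 1/(2 theta), and convergence in probability follows. *)

(** * Independence and Gaussian moments *)

(** As [Delta] is arbitrary, increments over the sampling grid would form a new array of variables
    for each n. With the mesh h fixed first, probability enters only through [W] on countably many
    grids. One null set is removed, the rest concerns a single path, and the sampling times come
    last.

    Why fourth powers: the point chosen in a block may depend on the path, so an increment met by
    the chain is only bounded by the sum over all increments of its level in the block. Squares sum
    to about h at every level j, fourth powers to about h^2 / 2^j, and this decay makes the levels
    summable.

    Why lag products suffice: the averages of the products of Y(k) with the increment xi(k+j) are
    bounded uniformly in the lag j. One step of the recursion trades lag j for lag j+1 and gains the
    factor a = 1 - theta h, up to lag products, which average to 0. Iterating, the cross terms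
    vanish, and squaring the recursion gives the average of Y^2.

    The squared distance of X to Y averages to at most a constant times h. Separating X^2 into Y^2
    and this distance with a parameter e divides the constant by e, so h of order e^2 is enough. *)

Section weighted_image.
Context d d' (T : measurableType d) (T' : measurableType d') (R : realType).
Variables (mu : {measure set T -> \bar R}) (nu : {measure set T' -> \bar R}).
Import HBNNSimple.

(** Both sides are linear and monotone in [f], and the hypothesis is the case of indicators. Weights
    allow two uses: with a density as [g] it computes Gaussian expectations, and with a function of
    another variable as [g] it gives the product rule under independence. *)
Lemma ge0_integral_weighted_image (X : T -> T') (g : T -> R) (c : R)
    (f : T' -> R) :
  measurable_fun [set: T] X -> measurable_fun [set: T] g ->
  (forall x, 0 <= g x) -> 0 <= c ->
  (forall A, measurable A ->
    \int[mu]_(x in X @^-1` A) (g x)%:E = c%:E * nu A)%E ->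
  measurable_fun [set: T'] f -> (forall y, 0 <= f y) ->
  (\int[mu]_x (f (X x) * g x)%:E = c%:E * \int[nu]_y (f y)%:E)%E.
Proof.
move=> mX mg g0 c0 gE /measurable_EFinP mf f0.
have ef0 y : (0 <= (EFin \o f) y)%E by rewrite lee_fin.
pose h := nnsfun_approx measurableT mf.
have hf y : EFin \o h^~ y @ \oo --> (f y)%:E by exact: cvg_nnsfun_approx.
have ndh n m y : (n <= m)%N -> h n y <= h m y.
  by move=> nm; exact/lefP/nd_nnsfun_approx.
have mh n : measurable_fun [set: T'] (EFin \o h n).
  by apply/measurable_EFinP; exact/measurable_funP.
have mhX n : measurable_fun [set: T] (fun x => (h n (X x) * g x)%:E).
  apply/measurable_EFinP; apply: measurable_funM => //.
  by apply: (measurableT_comp _ mX); exact/measurable_funP.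
have cvg1 : (\int[nu]_y (h n y)%:E)%E @[n --> \oo] --> (\int[nu]_y (f y)%:E)%E.
  rewrite (_ : (\int[nu]_y (f y)%:E = \int[nu]_y limn (fun n => (h n y)%:E))%E);
    last first.
    by apply: eq_integral => y _; apply/esym/cvg_lim => //; exact: hf.
  apply: cvg_monotone_convergence => //.
  - by move=> n y _; rewrite lee_fin.
  - by move=> y _ a b ab; rewrite lee_fin ndh.
have cvg2 : (\int[mu]_x (h n (X x) * g x)%:E)%E @[n --> \oo] -->
    (\int[mu]_x (f (X x) * g x)%:E)%E.
  rewrite (_ : (\int[mu]_x (f (X x) * g x)%:E =
      \int[mu]_x limn (fun n => (h n (X x) * g x)%:E))%E); last first.
    apply: eq_integral => x _; apply/esym/cvg_lim => //.
    under eq_fun do rewrite EFinM.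
    by rewrite EFinM; apply: cvgeZr => //; exact: hf.
  apply: cvg_monotone_convergence => //.
  - by move=> n x _; rewrite lee_fin mulr_ge0.
  - by move=> x _ a b ab; rewrite lee_fin ler_wpM2r// ndh.
have step n : (\int[mu]_x (h n (X x) * g x)%:E = c%:E * \int[nu]_y (h n y)%:E)%E.
  have mpre r : measurable (h n @^-1` [set r]) by exact: measurable_sfunP.
  have mXpre r : measurable (X @^-1` (h n @^-1` [set r])).
    by rewrite -[X in measurable X]setTI; exact: mX.
  transitivity (\int[mu]_x (\sum_(r \in range (h n))
      ((r * \1_(h n @^-1` [set r]) (X x) * g x)%:E)))%E.
    apply: eq_integral => x _; rewrite fimfunE.
    by rewrite fsumEFin// mulr_fsuml.
  rewrite ge0_integral_fsum//; last 2 first.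
  - move=> r; apply/measurable_EFinP; apply: measurable_funM => //.
    apply: measurable_funM => //; apply: (measurableT_comp _ mX).
    exact: measurable_indic.
  - move=> r x _; rewrite lee_fin mulr_ge0// -lee_fin.
    exact: nnfun_muleindic_ge0.
  have -> : (\int[nu]_y (h n y)%:E = \int[nu]_y (\sum_(r \in range (h n))
      ((r * \1_(h n @^-1` [set r]) y)%:E)))%E.
    by apply: eq_integral => y _; rewrite fimfunE -fsumEFin.
  rewrite ge0_integral_fsum//; last 2 first.
  - move=> r; apply/measurable_EFinP; apply: measurable_funM => //.
  - by move=> r y _; exact: nnfun_muleindic_ge0.
  rewrite ge0_mule_fsumr; last first.
    by move=> r; apply: integral_ge0 => y _; exact: nnfun_muleindic_ge0.
  apply: eq_fsbigr => r; rewrite inE => -[y0 _ <-].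
  set r0 := h n y0.
  have r00 : 0 <= r0 by [].
  under [in LHS]eq_integral do rewrite -mulrA EFinM.
  rewrite ge0_integralZl_EFin//; last 2 first.
  - by move=> x _; rewrite lee_fin mulr_ge0.
  - apply/measurable_EFinP; apply: measurable_funM => //.
    by apply: (measurableT_comp _ mX); exact: measurable_indic.
  under [in RHS]eq_integral do rewrite EFinM.
  rewrite ge0_integralZl_EFin//; last exact/measurable_EFinP/measurable_indic.
  rewrite integral_indic// setIT muleCA -gE//.
  congr *%E; rewrite [RHS]integral_mkcond; apply: eq_integral => x _.
  rewrite patchE indicE.
  rewrite (_ : (X x \in h n @^-1` [set r0]) = (x \in X @^-1` (h n @^-1` [set r0]))).
    by case: ifPn => _; rewrite ?mul1r ?mul0r.
  by apply/idP/idP; rewrite !inE.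
move: cvg2; under eq_fun do rewrite step.
move=> /cvg_lim <-//; apply/cvg_lim => //.
by apply: cvgeZl.
Qed.

End weighted_image.

Lemma ge0_expectation_prod d (T : measurableType d) (R : realType)
    (P : probability T R) (X Y : T -> R) (f g : R -> R) :
  measurable_fun [set: T] X -> measurable_fun [set: T] Y ->
  (forall A B, measurable A -> measurable B ->
    P (X @^-1` A `&` Y @^-1` B) = (P (X @^-1` A) * P (Y @^-1` B))%E) ->
  measurable_fun [set: R] f -> (forall y, 0 <= f y) ->
  measurable_fun [set: R] g -> (forall y, 0 <= g y) ->
  (\int[P]_x (f (X x))%:E < +oo)%E ->
  (\int[P]_x (f (X x) * g (Y x))%:E =
   \int[P]_x (f (X x))%:E * \int[P]_x (g (Y x))%:E)%E.
Proof.
move=> mX mY XY mf f0 mg g0 fX.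
have mpre (Z : T -> R) : measurable_fun setT Z -> forall A, measurable A ->
    measurable (Z @^-1` A).
  by move=> mZ A mA; rewrite -[X in measurable X]setTI; exact: mZ.
have lawE (Z : {mfun T >-> R}) (k : R -> R) : measurable_fun [set: R] k ->
    (forall y, 0 <= k y) -> (\int[P]_x (k (Z x))%:E =
    \int[pushforward P Z]_y (k y)%:E)%E.
  move=> mk k0; rewrite ge0_integral_pushforward//.
  - exact/measurable_EFinP.
  - by move=> y; rewrite lee_fin.
pose X' : {mfun T >-> R} := HB.pack X (isMeasurableFun.Build _ _ _ _ X mX).
pose Y' : {mfun T >-> R} := HB.pack Y (isMeasurableFun.Build _ _ _ _ Y mY).
have step1 B : measurable B ->
  (\int[P]_(x in Y @^-1` B) (f (X x))%:E =
   P (Y @^-1` B) * \int[P]_x (f (X x))%:E)%E.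
  move=> mB; rewrite (lawE X')//.
  have PB : P (Y @^-1` B) \is a fin_num by exact: fin_num_measure (mpre Y mY B mB).
  rewrite -(fineK PB) -(@ge0_integral_weighted_image _ _ _ _ _ P _ X
    (\1_(Y @^-1` B) : T -> R))//.
  - rewrite [LHS]integral_mkcond; apply: eq_integral => x _.
    by rewrite patchE /= indicE; case: ifPn => _; rewrite ?mulr1 ?mulr0.
  - by apply: measurable_indic; exact: mpre.
  - by rewrite fine_ge0.
  - move=> A mA; rewrite fineK// integral_indic; [|exact: mpre..].
    by rewrite [RHS]muleC -XY// setIC.
have EfX : (\int[P]_x (f (X x))%:E)%E \is a fin_num.
  by rewrite ge0_fin_numE// integral_ge0// => x _; rewrite lee_fin.
rewrite (lawE Y' g)// -(fineK EfX).
rewrite -(@ge0_integral_weighted_image _ _ _ _ _ P _ Y (f \o X))//.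
- by apply: eq_integral => x _; rewrite mulrC.
- exact: measurableT_comp.
- by move=> x /=.
- by rewrite fine_ge0// integral_ge0// => x _; rewrite lee_fin.
- by move=> B mB; rewrite step1// fineK// muleC.
Qed.

(** * Moments of a centred Gaussian variable, all drawn from one exponential moment *)

Section gaussian_moments.
Context d (T : measurableType d) (R : realType) (P : probability T R).
Variables (Z : T -> R) (s : R).
Hypothesis mZ : measurable_fun [set: T] Z.
Hypothesis s_gt0 : 0 < s.
Hypothesis lawZ : forall A : set R, measurable A ->
  P (Z @^-1` A) = normal_prob 0 s A.

Lemma ge0_expectation_gaussian (f : R -> R) :
  measurable_fun [set: R] f -> (forall y, 0 <= f y) ->
  (\int[P]_x (f (Z x))%:E =
   \int[lebesgue_measure]_y (f y * normal_pdf 0 s y)%:E)%E.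
Proof.
move=> mf f0.
have -> : (\int[P]_x (f (Z x))%:E = \int[P]_x (f (Z x) * 1)%:E)%E.
  by under [RHS]eq_integral do rewrite mulr1.
rewrite (@ge0_integral_weighted_image _ _ _ _ _ _ (normal_prob 0 s)
  Z (cst 1) 1)//; last first.
  move=> A mA; have mZA : measurable (Z @^-1` A).
    by have := mZ measurableT _ mA; rewrite setTI.
  transitivity (\int[P]_(x in Z @^-1` A) (cst 1%E x))%E => //.
  by rewrite integral_cst// !mul1e; exact: lawZ.
apply/esym; apply: (@ge0_integral_weighted_image _ _ _ _ _ lebesgue_measure
  (normal_prob 0 s) id (normal_pdf 0 s) 1) => //.
- exact: measurable_normal_pdf.
- by move=> x; exact: normal_pdf_ge0.
- by move=> A mA; rewrite mul1e.
Qed.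

(* The weight only rescales the density: it turns s into s / q. *)
Lemma expectation_gaussian_expR_sqr (q : R) : 0 < q ->
  (\int[P]_x (expR ((1 - q ^+ 2) / (2 * s ^+ 2) * Z x ^+ 2))%:E = q^-1%:E)%E.
Proof.
move=> q0.
rewrite (@ge0_expectation_gaussian
  (fun y => expR ((1 - q ^+ 2) / (2 * s ^+ 2) * y ^+ 2))); first last.
  by move=> y; exact: expR_ge0.
  apply: measurableT_comp => //; apply: measurable_funM => //.
have q0' : q != 0 by rewrite gt_eqF.
have s0' : s != 0 by rewrite gt_eqF.
have s0 := ltW s_gt0.
have pE y : expR ((1 - q ^+ 2) / (2 * s ^+ 2) * y ^+ 2) * normal_pdf 0 s y =
    q^-1 * normal_pdf 0 (s / q) y.
  rewrite !normal_pdfE ?mulf_neq0 ?invr_neq0//.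
  have -> : normal_peak (s / q) = q * normal_peak s.
    rewrite /normal_peak; have p0 := pi_ge0 R.
    have aux (a b c : R) : (a / b) ^+ 2 * c *+ 2 = (a ^+ 2 * c *+ 2) * b^-1 ^+ 2.
      by rewrite exprMn mulrAC mulrnAl.
    rewrite aux.
    rewrite sqrtrM ?mulrn_wge0 ?mulr_ge0 ?sqr_ge0//.
    by rewrite sqrtr_sqr gtr0_norm ?invr_gt0// invfM invrK mulrC.
  have E : expR ((1 - q ^+ 2) / (2 * s ^+ 2) * y ^+ 2) * normal_fun 0 s y =
      normal_fun 0 (s / q) y.
    rewrite /normal_fun -expRD; congr expR.
    by rewrite !subr0; field; rewrite q0' s0'.
  by rewrite mulrCA E !mulrA mulVf// mul1r.
under eq_integral do rewrite pE EFinM.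
rewrite ge0_integralZl_EFin//.
- by rewrite integral_normal_pdf mule1.
- by move=> y _; rewrite lee_fin normal_pdf_ge0.
- by apply/measurable_EFinP; exact: measurable_normal_pdf.
- by rewrite invr_ge0 ltW.
Qed.

Let mZn n : measurable_fun [set: T] (fun x => Z x ^+ n).
Proof. exact: measurable_funX. Qed.

Let mE c : measurable_fun [set: T] (fun x => expR (c * Z x ^+ 2)).
Proof. by apply: measurableT_comp => //; apply: measurable_funM. Qed.

(** Take q = 1/2 in the exponential moment, so that u = 3 Z^2 / (8 s^2), and use (u/4)^4 <= exp u.
    Then (8/3)^4 * 2^8 <= 2^14, and the expectation of exp u is 2. *)
Lemma expectation_gaussian_pow8 : (\int[P]_x (Z x ^+ 8)%:E <= (2 ^+ 15 * s ^+ 8)%:E)%E.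
Proof.
have s8 : 0 <= s ^+ 8 by rewrite exprn_ge0// ltW.
apply: (@le_trans _ _ (\int[P]_x (2 ^+ 14 * s ^+ 8 *
    expR ((1 - (2^-1) ^+ 2) / (2 * s ^+ 2) * Z x ^+ 2))%:E)%E).
  apply: ge0_le_integral => //.
  - by move=> x _; rewrite lee_fin (exprM _ 2 4) exprn_ge0// sqr_ge0.
  - exact/measurable_EFinP.
  - by apply/measurable_EFinP; apply: measurable_funM.
  - move=> x _; rewrite lee_fin.
    set u := (1 - _) / _ * _.
    have u0 : 0 <= u.
      rewrite /u (_ : 1 - _ = 3 / 4); last by field.
      by rewrite mulr_ge0 ?sqr_ge0// divr_ge0// mulr_ge0// sqr_ge0.
    have -> : Z x ^+ 8 = (8 / 3) ^+ 4 * s ^+ 8 * u ^+ 4.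
      by rewrite /u; field; rewrite gt_eqF.
    have H : (u / 4) ^+ 4 <= expR u.
      have -> : u = u / 4 * 4%:R by field.
      rewrite expRM_natr mulfK//; apply: lerXn2r; rewrite ?nnegrE ?expR_ge0//.
        by rewrite divr_ge0.
      by apply: le_trans (expR_ge1Dx _); lra.
    have -> : (8 / 3) ^+ 4 * s ^+ 8 * u ^+ 4 = (8 / 3) ^+ 4 * 2 ^+ 8 * s ^+ 8 * (u / 4) ^+ 4.
      by field.
    apply: ler_pM => //.
    - by apply: mulr_ge0 => //; apply: mulr_ge0; apply: exprn_ge0.
    - by rewrite exprn_ge0// divr_ge0.
    - by rewrite ler_wpM2r//; lra.
under eq_integral do rewrite EFinM.
rewrite ge0_integralZl_EFin//; last 2 first.
  exact/measurable_EFinP.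
  by rewrite mulr_ge0.
rewrite expectation_gaussian_expR_sqr// -EFinM lee_fin invrK; lra.
Qed.

(** AM-GM reduces this to the eighth moment: Z^4 <= (s^4 + Z^8 / s^4) / 2. *)
Lemma expectation_gaussian_pow4 : (\int[P]_x (Z x ^+ 4)%:E <= (2 ^+ 15 * s ^+ 4)%:E)%E.
Proof.
have s4 : 0 < s ^+ 4 by rewrite exprn_gt0.
apply: (@le_trans _ _ (\int[P]_x (2^-1 * s ^+ 4 + (2 * s ^+ 4)^-1 * Z x ^+ 8)%:E)%E).
  apply: ge0_le_integral => //.
  - by move=> x _; rewrite lee_fin (exprM _ 2 2) exprn_ge0// sqr_ge0.
  - exact/measurable_EFinP.
  - apply/measurable_EFinP; apply: measurable_funD => //.
    exact: measurable_funM.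
  - move=> x _; rewrite lee_fin -subr_ge0.
    have -> : 2^-1 * s ^+ 4 + (2 * s ^+ 4)^-1 * Z x ^+ 8 - Z x ^+ 4 =
      (s ^+ 4 - Z x ^+ 4) ^+ 2 / (2 * s ^+ 4) by field; rewrite gt_eqF.
    by rewrite divr_ge0 ?sqr_ge0// mulr_ge0// ltW.
under eq_integral do rewrite EFinD (EFinM (2 * s ^+ 4)^-1).
have Z8 x : (0 <= (Z x ^+ 8)%:E)%E.
  by rewrite lee_fin (exprM _ 2 4) exprn_ge0// sqr_ge0.
have c0 : 0 <= (2 * s ^+ 4)^-1 by rewrite invr_ge0 mulr_ge0// ltW.
rewrite ge0_integralD//; last 3 first.
  by move=> x _; rewrite lee_fin mulr_ge0// ltW.
  by move=> x _; rewrite mule_ge0// lee_fin.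
  by apply/measurable_EFinP; exact: measurable_funM.
rewrite integral_cst// ge0_integralZl_EFin//; last exact/measurable_EFinP.
rewrite [X in (_ * X + _)%E](_ : _ = 1%E); last exact: probability_setT.
rewrite mule1.
apply: (@le_trans _ _ (2^-1 * s ^+ 4 + (2 * s ^+ 4)^-1 * (2 ^+ 15 * s ^+ 8))%:E); last first.
  rewrite lee_fin (_ : (2 * s ^+ 4)^-1 * _ = 2 ^+ 14 * s ^+ 4); first by nra.
  by field; rewrite gt_eqF.
rewrite EFinD leeD// [leRHS]EFinM lee_pmul//.
- by apply: integral_ge0.
- exact: expectation_gaussian_pow8.
Qed.

(** Unlike the higher moments, this one must be exact: it is the limit of the quadratic variation
    and hence determines the limit of the estimator. *)
Lemma expectation_gaussian_sqr : (\int[P]_x (Z x ^+ 2)%:E = (s ^+ 2)%:E)%E.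
Proof.
have s2 : 0 < s ^+ 2 by rewrite exprn_gt0.
have Z2 x : (0 <= (Z x ^+ 2)%:E)%E by rewrite lee_fin sqr_ge0.
have mZ2 : measurable_fun [set: T] (fun x => (Z x ^+ 2)%:E).
  exact/measurable_EFinP.
have P1 : P [set: T] = 1%E by exact: probability_setT.
(* [1 + u <= expR u] pinches the second moment from both sides as q -> 1. *)
have ub (q : R) : 0 < q -> q < 1 ->
    (1 + ((1 - q ^+ 2) / (2 * s ^+ 2))%:E * \int[P]_x (Z x ^+ 2)%:E <= q^-1%:E)%E.
  move=> q0 q1; rewrite -expectation_gaussian_expR_sqr//.
  have c0 : 0 <= (1 - q ^+ 2) / (2 * s ^+ 2).
    by apply: divr_ge0; [nra|rewrite mulr_ge0// ltW].
  have -> : (1 = \int[P]_x (cst 1%E x))%E by rewrite integral_cst// mul1e; exact: esym P1.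
  rewrite -ge0_integralZl_EFin// -ge0_integralD//; last 2 first.
    by move=> x _; rewrite mule_ge0.
    by apply/measurable_EFinP; exact: measurable_funM.
  apply: ge0_le_integral => //.
  - by move=> x _; rewrite adde_ge0// mule_ge0.
  - by apply/measurable_EFinP; apply: measurable_funD => //; exact: measurable_funM.
  - exact/measurable_EFinP.
  - by move=> x _; rewrite -EFinM -EFinD lee_fin expR_ge1Dx.
have lb (q : R) : 1 < q ->
    (1 <= q^-1%:E + ((q ^+ 2 - 1) / (2 * s ^+ 2))%:E * \int[P]_x (Z x ^+ 2)%:E)%E.
  move=> q1; rewrite -expectation_gaussian_expR_sqr//; last by lra.
  have c0 : 0 <= (q ^+ 2 - 1) / (2 * s ^+ 2).
    by apply: divr_ge0; [nra|rewrite mulr_ge0// ltW].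
  have -> : (1 = \int[P]_x (cst 1%E x))%E by rewrite integral_cst// mul1e; exact: esym P1.
  rewrite -ge0_integralZl_EFin// -ge0_integralD//; last 3 first.
    exact/measurable_EFinP.
    by move=> x _; rewrite mule_ge0.
    by apply/measurable_EFinP; exact: measurable_funM.
  apply: ge0_le_integral => //.
  - by apply/measurable_EFinP; apply: measurable_funD => //; exact: measurable_funM.
  - move=> x _; rewrite -EFinM -EFinD lee_fin.
    apply: (@le_trans _ _ (1 + (1 - q ^+ 2) / (2 * s ^+ 2) * Z x ^+ 2 +
      (q ^+ 2 - 1) / (2 * s ^+ 2) * Z x ^+ 2)).
      by rewrite -addrA -mulrDl -mulrDl (_ : 1 - _ + _ = 0) ?mul0r ?addr0//; lra.
    by rewrite lerD2r expR_ge1Dx.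
(* If the moment were infinite, the upper bound at q = 1/2 would read +oo <= 2. *)
have Zfin : (\int[P]_x (Z x ^+ 2)%:E)%E \is a fin_num.
  rewrite ge0_fin_numE ?integral_ge0// ltey; apply/eqP => Zy.
  have := ub 2^-1 ltac:(lra) ltac:(lra); rewrite Zy gt0_muley//.
  by rewrite lte_fin divr_gt0 ?mulr_gt0//; nra.
rewrite -(fineK Zfin) in ub lb *.
set V := fine _ in ub lb *.
have V0 : 0 <= V by rewrite fine_ge0// integral_ge0.
congr EFin; apply/eqP; rewrite eq_le; apply/andP; split.
(* With q = 1 - t the bound becomes V (1 - t) (2 - t) <= 2 s^2, whose linear error 3 t V / 2 is
   absorbed by the choice of t. The other direction is the same with q = 1 + t. *)
- apply/ler_addgt0Pr => e e0.
  pose t := Num.min 2^-1 (e / (3 * V + 1)).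
  have V3 : 0 < 3 * V + 1 by lra.
  have t0 : 0 < t by rewrite lt_min; apply/andP; split; [lra|rewrite divr_gt0].
  have t1 : t <= 2^-1 by rewrite ge_min lexx.
  have t2 : t * (3 * V + 1) <= e by rewrite -ler_pdivlMr// ge_min lexx orbT.
  clearbody t.
  have := ub (1 - t) ltac:(lra) ltac:(lra).
  rewrite -EFinM -EFinD lee_fin => H.
  have : V * ((1 - t) * (2 - t)) <= 2 * s ^+ 2.
    have -> : V * ((1 - t) * (2 - t)) = (1 - t) * (2 * s ^+ 2 / t) *
       (1 + (1 - (1 - t) ^+ 2) / (2 * s ^+ 2) * V - 1).
      by field; rewrite !gt_eqF.
    rewrite [leRHS](_ : _ = (1 - t) * (2 * s ^+ 2 / t) * ((1 - t)^-1 - 1)); last first.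
      by field; rewrite !gt_eqF//; lra.
    rewrite ler_wpM2l//; last by lra.
    by apply: mulr_ge0; [lra|apply: divr_ge0; lra].
  have : 0 <= t * t * V by rewrite !mulr_ge0// ltW.
  nra.
- apply/ler_addgt0Pr => e e0.
  pose t := Num.min 1 (e / (4 * V + 1)).
  have V3 : 0 < 4 * V + 1 by lra.
  have t0 : 0 < t by rewrite lt_min; apply/andP; split; [lra|rewrite divr_gt0].
  have t1 : t <= 1 by rewrite ge_min lexx.
  have t2 : t * (4 * V + 1) <= e by rewrite -ler_pdivlMr// ge_min lexx orbT.
  clearbody t.
  have := lb (1 + t) ltac:(lra).
  rewrite -EFinM -EFinD lee_fin => H.
  have : 2 * s ^+ 2 <= V * ((1 + t) * (2 + t)).
    have -> : V * ((1 + t) * (2 + t)) = (1 + t) * (2 * s ^+ 2 / t) *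
       ((1 + t)^-1 + ((1 + t) ^+ 2 - 1) / (2 * s ^+ 2) * V - (1 + t)^-1).
      by field; rewrite !gt_eqF//; lra.
    rewrite [leLHS](_ : _ = (1 + t) * (2 * s ^+ 2 / t) * (1 - (1 + t)^-1)); last first.
      by field; rewrite !gt_eqF//; lra.
    rewrite ler_wpM2l//; last by lra.
    by apply: mulr_ge0; [lra|apply: divr_ge0; lra].
  have : t * t * V <= t * V.
    by rewrite -mulrA ler_piMl// mulr_ge0// ltW.
  nra.
Qed.

End gaussian_moments.

(** * Averages of uncorrelated nonnegative variables *)

Lemma sum_nat_window (N k l : nat) :
  (\sum_(j < N) (k <= j < k + l) = minn N (k + l) - minn N k)%N.
Proof.
elim: N => [|N IH]; first by rewrite big_ord0 !min0n.
by rewrite big_ord_recr /= IH; lia.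
Qed.

Section second_moment.
Context d (T : measurableType d) (R : realType) (P : probability T R).
Variables (z : nat -> T -> R) (m v : R) (l : nat).
Hypothesis mz : forall k, measurable_fun [set: T] (z k).
Hypothesis z_ge0 : forall k x, 0 <= z k x.
Hypothesis m_ge0 : 0 <= m.
Hypothesis v_ge0 : 0 <= v.
Hypothesis z_mean : forall k, (\int[P]_x (z k x)%:E = m%:E)%E.
Hypothesis z_far : forall k j, (k + l <= j)%N ->
  (\int[P]_x (z k x * z j x)%:E <= (m ^+ 2)%:E)%E.
Hypothesis z_sqr : forall k, (\int[P]_x (z k x ^+ 2)%:E <= v%:E)%E.

Lemma z_near k j : (\int[P]_x (z k x * z j x)%:E <= v%:E)%E.
Proof.
have mz2 i : measurable_fun [set: T] (fun x => (z i x ^+ 2)%:E).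
  by apply/measurable_EFinP; exact: measurable_funX.
have z20 i x : (0 <= (z i x ^+ 2)%:E)%E by rewrite lee_fin sqr_ge0.
apply: (@le_trans _ _ (\int[P]_x (2^-1%:E * ((z k x ^+ 2)%:E + (z j x ^+ 2)%:E)))%E).
  apply: ge0_le_integral => //.
  - by move=> x _; rewrite lee_fin mulr_ge0.
  - by apply/measurable_EFinP; exact: measurable_funM.
  - by apply: measurable_funeM; exact: emeasurable_funD.
  - move=> x _; rewrite -EFinD -EFinM lee_fin -subr_ge0.
    have -> : 2^-1 * (z k x ^+ 2 + z j x ^+ 2) - z k x * z j x =
      2^-1 * (z k x - z j x) ^+ 2 by field.
    by rewrite mulr_ge0// sqr_ge0.
rewrite ge0_integralZl_EFin//; last 2 first.
- by move=> x _; rewrite adde_ge0.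
- exact: emeasurable_funD.
rewrite ge0_integralD//.
apply: (@le_trans _ _ (2^-1%:E * (v%:E + v%:E))%E).
  by rewrite lee_pmul2l// ?leeD// lte_fin; lra.
by rewrite -EFinD -EFinM lee_fin; lra.
Qed.

(** One formula for all pairs, far or near, so that summing over pairs only requires counting the
    band around the diagonal, at most 2 N l pairs. *)
Lemma integral_prod_le k j : (\int[P]_x (z k x * z j x)%:E <=
  (m ^+ 2 + v * (k <= j < k + l)%:R + v * (j <= k < j + l)%:R)%:E)%E.
Proof.
have m2 : 0 <= m ^+ 2 by exact: sqr_ge0.
have [kj|jk] := leqP k j.
- have [far|near] := leqP (k + l) j.
    apply: (le_trans (z_far _ _ far)); rewrite lee_fin -addrA lerDl.
    by rewrite addr_ge0// mulr_ge0.
  apply: (le_trans (z_near _ _)); rewrite lee_fin mulr1.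
  by rewrite addrAC lerDr addr_ge0// mulr_ge0.
- have [far|near] := leqP (j + l) k.
    under eq_integral do rewrite mulrC.
    apply: (le_trans (z_far _ _ far)); rewrite lee_fin -addrA lerDl.
    by rewrite addr_ge0// mulr_ge0.
  apply: (le_trans (z_near _ _)); rewrite lee_fin (ltnW jk) mulr1.
  by rewrite lerDr addr_ge0// mulr_ge0.
Qed.

Lemma integral_sum_sqr_le N : (\int[P]_x ((\sum_(k < N) z k x) ^+ 2)%:E <=
  (N%:R ^+ 2 * m ^+ 2 + 2 * N%:R * l%:R * v)%:E)%E.
Proof.
have -> : (\int[P]_x ((\sum_(k < N) z k x) ^+ 2)%:E =
    \sum_(k < N) \sum_(j < N) \int[P]_x (z k x * z j x)%:E)%E.
  transitivity (\int[P]_x (\sum_(k < N) \sum_(j < N) (z k x * z j x)%:E))%E.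
    apply: eq_integral => x _; rewrite expr2 big_distrlr/= -sumEFin.
    by apply: eq_bigr => k _; rewrite sumEFin.
  have mzz k j : measurable_fun [set: T] (fun x => (z k x * z j x)%:E).
    by apply/measurable_EFinP; exact: measurable_funM.
  have zz0 k j x : (0 <= (z k x * z j x)%:E)%E by rewrite lee_fin mulr_ge0.
  rewrite ge0_integral_sum//; last 2 first.
  - by move=> k; exact: emeasurable_sum.
  - by move=> k x _; exact: sume_ge0.
  by apply: eq_bigr => k _; rewrite ge0_integral_sum.
apply: (@le_trans _ _ (\sum_(k < N) \sum_(j < N)
  (m ^+ 2 + v * (k <= j < k + l)%:R + v * (j <= k < j + l)%:R)%:E)%E).
  by apply: lee_sum => k _; apply: lee_sum => j _; exact: integral_prod_le.
under eq_bigr do rewrite sumEFin.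
rewrite sumEFin lee_fin.
have win k : \sum_(j < N) (k <= j < k + l)%:R <= l%:R :> R.
  by rewrite -natr_sum sum_nat_window ler_nat; lia.
under eq_bigr do rewrite !big_split/=.
rewrite !big_split/= [X in _ + X]exchange_big/=.
rewrite sumr_const card_ord sumr_const card_ord -[_ *+ _ *+ _]mulrnA -[X in X + _ + _]mulr_natl natrM -expr2.
rewrite -addrA lerD2l.
have -> : 2 * N%:R * l%:R * v = N%:R * (l%:R * v) + N%:R * (l%:R * v) by ring.
have b : \sum_(i < N) \sum_(j < N) v * (i <= j < i + l)%:R <= N%:R * (l%:R * v).
  rewrite -[leRHS](_ : \sum_(i < N) (l%:R * v) = _); last first.
    by rewrite sumr_const card_ord [RHS]mulr_natl.
  by apply: ler_sum => i _; rewrite -mulr_sumr mulrC ler_wpM2r.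
by rewrite lerD.
Qed.

Lemma centered_second_moment_le N :
  (\int[P]_x ((\sum_(k < N) z k x - N%:R * m) ^+ 2)%:E <=
   (2 * N%:R * l%:R * v)%:E)%E.
Proof.
pose F x := \sum_(k < N) z k x.
have mF : measurable_fun [set: T] F by exact: measurable_sum.
have F0 x : 0 <= F x by exact: sumr_ge0.
have Nm : 0 <= N%:R * m by rewrite mulr_ge0.
have intF : (\int[P]_x (F x)%:E = (N%:R * m)%:E)%E.
  under eq_integral do rewrite -sumEFin.
  rewrite ge0_integral_sum//; last 2 first.
    by move=> k; exact/measurable_EFinP.
    by move=> k x _; rewrite lee_fin.
  under eq_bigr do rewrite z_mean.
  by rewrite sumEFin sumr_const card_ord mulr_natl.
have mC : measurable_fun [set: T] (fun x => (F x - N%:R * m) ^+ 2).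
  by apply: measurable_funX; exact: measurable_funB.
(* The expanded square with its negative cross term moved to the other side: every integrand is then
   nonnegative and no integrability is required. *)
have key : (\int[P]_x ((F x - N%:R * m) ^+ 2)%:E + (2 * (N%:R * m) ^+ 2)%:E =
    \int[P]_x ((F x) ^+ 2)%:E + ((N%:R * m) ^+ 2)%:E)%E.
  have -> : ((2 * (N%:R * m) ^+ 2)%:E = \int[P]_x (2 * (N%:R * m) * F x)%:E)%E.
    under eq_integral do rewrite EFinM.
    rewrite ge0_integralZl_EFin//; last 3 first.
      by move=> x _; rewrite lee_fin.
      exact/measurable_EFinP.
      by rewrite mulr_ge0.
    by rewrite intF -EFinM; congr EFin; ring.
  have -> : (((N%:R * m) ^+ 2)%:E = \int[P]_x (cst ((N%:R * m) ^+ 2)%:E x))%E.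
    rewrite integral_cst// [X in (_ * X)%E](_ : _ = 1%E) ?mule1//.
    exact: probability_setT.
  rewrite -!ge0_integralD//.
  - by apply: eq_integral => x _; rewrite -!EFinD; congr EFin; ring.
  - by move=> x _; rewrite lee_fin sqr_ge0.
  - by apply/measurable_EFinP; exact: measurable_funX.
  - by move=> x _; rewrite lee_fin sqr_ge0.
  - by move=> x _; rewrite lee_fin sqr_ge0.
  - exact/measurable_EFinP.
  - by move=> x _; rewrite lee_fin mulr_ge0// mulr_ge0.
  - by apply/measurable_EFinP; exact: measurable_funM.
rewrite -(@leeD2rE _ (2 * (N%:R * m) ^+ 2)%:E)// key.
apply: (le_trans (leeD2r _ (integral_sum_sqr_le N))).
by rewrite -EFinD lee_fin; lra.
Qed.

End second_moment.

(** * Almost sure convergence from summable expectations *)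

Section ae_convergence.
Context d (T : measurableType d) (R : realType) (P : probability T R).

(** The sum of the [g n] has finite expectation, so it is almost surely finite and its terms tend to
    0. Values in the extended reals are allowed because [g n] will itself be a series over dyadic
    levels. *)
Lemma ae_cvg0_of_series (g : nat -> T -> \bar R) :
  (forall n, measurable_fun [set: T] (g n)) -> (forall n x, 0 <= g n x)%E ->
  (\sum_(0 <= n <oo) \int[P]_x g n x < +oo)%E ->
  {ae P, forall x, forall e : R, 0 < e -> \forall n \near \oo, (g n x <= e%:E)%E}.
Proof.
move=> mg g0 sg.
pose G x := (\sum_(0 <= n <oo) g n x)%E.
have mG : measurable_fun [set: T] G by exact: ge0_emeasurable_sum.
have G0 x : (0 <= G x)%E by exact: nneseries_ge0.
have iG : P.-integrable [set: T] G.
  apply/integrableP; split => //.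
  under eq_integral do rewrite gee0_abs//.
  by rewrite integral_nneseries.
have := integrable_ae measurableT iG.
apply: filterS => x /(_ I) Gx.
have Gxy : (\sum_(0 <= n <oo) g n x < +oo)%E
  by move: Gx; rewrite ge0_fin_numE//; exact: G0.
have tl := nneseries_tail_cvg Gxy (fun n _ => g0 n x).
suff /fine_cvgP[gfin /cvgrPdist_le gcvg] : g ^~ x @ \oo --> 0%E.
  move=> e /gcvg; apply: filterS2 gfin => n gn /=.
  rewrite sub0r normrN ger0_norm ?fine_ge0//.
  by rewrite -lee_fin fineK.
apply: (@squeeze_cvge _ _ _ _ (cst 0%E) _ (fun n => (\sum_(n <= k <oo) g k x)%E)) => //.
- near=> n; rewrite g0/=.
  by apply: le_trans (nneseries_lim_ge n.+1 (fun k _ _ => g0 k x)); rewrite big_nat1.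
- exact: cvg_cst.
Unshelve. all: end_near. Qed.

(** Telescoping: the partial sums stay below 2 c - c / (n + 1). *)
Lemma nneseries_inv_sqr_lty (c : R) : 0 <= c ->
  (\sum_(0 <= n <oo) (c / n.+1%:R ^+ 2)%:E < +oo)%E.
Proof.
move=> c0; apply: (@le_lt_trans _ _ (2 * c)%:E); last exact: ltry.
apply: lime_le.
  by apply: is_cvg_nneseries => n _ _; rewrite lee_fin divr_ge0// sqr_ge0.
have H n : \sum_(0 <= i < n.+1) c / i.+1%:R ^+ 2 <= 2 * c - c / n.+1%:R.
  elim: n => [|n IH]; first by rewrite big_nat1 expr1n; lra.
  rewrite big_nat_recr//=; apply: (le_trans (lerD IH (lexx _))).
  rewrite -[n.+2%:R]natr1; set x : R := n.+1%:R.
  have x0 : 0 < x by rewrite ltr0n.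
  rewrite -addrA lerD2l -subr_ge0.
  have -> : - (c / (x + 1)) - (- (c / x) + c / (x + 1) ^+ 2) =
      c / (x * (x + 1) ^+ 2) by field; rewrite !gt_eqF//; lra.
  by rewrite divr_ge0// mulr_ge0 ?sqr_ge0// ltW.
near=> n; have n0 : (0 < n)%N by near: n; exists 1%N.
rewrite sumEFin lee_fin -(prednK n0); apply: (le_trans (H _)).
by rewrite gerBl divr_ge0.
Unshelve. all: end_near. Qed.

End ae_convergence.

Section monotone_averages.
Context (R : realType).

Lemma between_squares N : (0 < N)%N ->
  exists m, (m.+1 ^ 2 <= N < m.+2 ^ 2)%N.
Proof.
elim: N => // -[_ _|N /(_ isT)[m /andP[m1 m2]] _]; first by exists 0%N.
have [h|h] := ltnP N.+2 (m.+2 ^ 2)%N; first by exists m; lia.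
by exists m.+1; apply/andP; split=> //; rewrite !expnS expn0 in m1 m2 h *; nia.
Qed.

(** The partial sums are nondecreasing, so the sum up to N lies between those at the two
    neighbouring squares, and the ratio of consecutive squares tends to 1. *)
Lemma cvg_average_of_squares (f : nat -> R) (mu : R) :
  (forall k, 0 <= f k) -> 0 <= mu ->
  (\sum_(k < (m.+1 ^ 2)%N) f k) / (m.+1 ^ 2)%:R @[m --> \oo] --> mu ->
  (\sum_(k < N) f k) / N%:R @[N --> \oo] --> mu.
Proof.
move=> f0 mu0 /cvgrPdist_le h; apply/cvgrPdist_le => e e0.
pose t := Num.min 1 (e / (mu + 2)).
have mu2 : 0 < mu + 2 by lra.
have t0 : 0 < t by rewrite lt_min ltr01/= divr_gt0.
have t1 : t <= 1 by rewrite ge_min lexx.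
have te : t * (mu + 2) <= e by rewrite -ler_pdivlMr// ge_min lexx orbT.
have [M1 _ hM1] := h _ t0; clearbody t.
(* Once t (m+1) >= 4, the increase 2 (m+1) + 1 from one square to the next is at most t (m+1)^2. *)
have [M2 hM2] : exists M, forall m, (M <= m)%N -> m.+2%:R ^+ 2 <= (1 + t) * m.+1%:R ^+ 2 :> R.
  exists (Num.truncn (4 / t)) => m Mm.
  have tm : 4 <= t * m.+1%:R.
    rewrite mulrC -ler_pdivrMr//; apply/ltW; apply: lt_le_trans (truncnS_gt _) _.
    by rewrite ler_nat.
  rewrite -[m.+2%:R]natr1; have m1 : 1 <= m.+1%:R :> R by rewrite ler1n.
  nra.
exists ((maxn M1 M2).+2 ^ 2)%N => // N /= MN.
have N0 : (0 < N)%N by apply: leq_trans MN; rewrite expn_gt0.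
have [m /andP[m1 m2]] := between_squares N N0.
have mM : (maxn M1 M2 <= m)%N.
  have : ((maxn M1 M2).+2 ^ 2 < m.+2 ^ 2)%N by exact: leq_ltn_trans MN m2.
  by rewrite ltn_exp2r//; lia.
have {}hM2 := hM2 m (leq_trans (leq_maxr _ _) mM).
have hm : `|mu - (\sum_(k < (m.+1 ^ 2)%N) f k) / (m.+1 ^ 2)%:R| <= t.
  by apply: hM1 => /=; exact: leq_trans (leq_maxl _ _) mM.
have hm1 : `|mu - (\sum_(k < (m.+2 ^ 2)%N) f k) / (m.+2 ^ 2)%:R| <= t.
  by apply: hM1 => /=; exact: leq_trans (leq_trans (leq_maxl _ _) mM) _.
have mono a b : (a <= b)%N -> \sum_(k < a) f k <= \sum_(k < b) f k.
  move=> ab; rewrite -(subnKC ab) big_split_ord/= lerDl.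
  by apply: sumr_ge0 => k _.
have A1 := mono _ _ m1; have A2 := mono _ _ (ltnW m2).
have AN : 0 <= \sum_(k < N) f k by exact: sumr_ge0.
move: A1 A2 AN hm hm1.
move: (\sum_(k < N) f k) (\sum_(k < (m.+1 ^ 2)%N) f k)
  (\sum_(k < (m.+2 ^ 2)%N) f k) => A B C A1 A2 AN hm hm1.
have N0' : 0 < N%:R :> R by rewrite ltr0n.
have c1 : 0 < (m.+1 ^ 2)%:R :> R by rewrite ltr0n expn_gt0.
have c2 : 0 < (m.+2 ^ 2)%:R :> R by rewrite ltr0n expn_gt0.
have n1 : (m.+1 ^ 2)%:R <= N%:R :> R by rewrite ler_nat.
have n2 : N%:R <= (m.+2 ^ 2)%:R :> R by rewrite ler_nat ltnW.
rewrite -!natrX in hM2.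
move: c1 c2 n1 n2 hM2 hm hm1 => /=.
move: (m.+1 ^ 2)%:R (m.+2 ^ 2)%:R N%:R N0' => p q n n0 p0 q0 pn nq qp.
have tB : (mu - t) * p <= B -> C <= (mu + t) * q -> `|mu - A / n| <= e.
  move=> hB hC; rewrite ler_distlC; apply/andP; split.
  - rewrite ler_pdivlMr//; apply: le_trans A1; apply: le_trans hB.
    have [mut|mut] := leP t mu.
      apply: (@le_trans _ _ ((mu - e) * n)) => //.
      have : (mu - e) <= (mu - t) * (1 - t) by nra.
      move=> H; apply: (le_trans (ler_wpM2r (ltW n0) H)).
      rewrite -mulrA ler_wpM2l ?subr_ge0//.
      have : (1 - t) * n <= (1 - t) * ((1 + t) * p) by apply: ler_wpM2l; nra.
      nra.
    nra.
  - rewrite ler_pdivrMr//; apply: (le_trans A2); apply: (le_trans hC).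
    have : (mu + t) * (1 + t) <= mu + e by nra.
    move=> H; apply: (@le_trans _ _ ((mu + t) * (1 + t) * n)); last by rewrite ler_wpM2r// ltW.
    by rewrite -mulrA ler_wpM2l; nra.
rewrite ler_distlC => /andP[hB _]; rewrite ler_distlC => /andP[_ hC].
by apply: tB; [rewrite -ler_pdivlMr|rewrite -ler_pdivrMr].
Qed.

End monotone_averages.

(** Only pairs at distance less than l can be correlated, so the average of N terms has variance
    O(1/N). This is summable along N = (n+1)^2, and monotonicity fills the gaps. *)
Lemma ae_cvg_average d (T : measurableType d) (R : realType)
    (P : probability T R) (z : nat -> T -> R) (m v : R) (l : nat) :
  (forall k, measurable_fun [set: T] (z k)) -> (forall k x, 0 <= z k x) ->
  0 <= m -> 0 <= v ->
  (forall k, (\int[P]_x (z k x)%:E = m%:E)%E) ->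
  (forall k j, (k + l <= j)%N ->
    (\int[P]_x (z k x * z j x)%:E <= (m ^+ 2)%:E)%E) ->
  (forall k, (\int[P]_x (z k x ^+ 2)%:E <= v%:E)%E) ->
  {ae P, forall x, (\sum_(k < N) z k x) / N%:R @[N --> \oo] --> m}.
Proof.
move=> mz z0 m0 v0 zm zf zs.
pose g n x := (((\sum_(k < (n.+1 ^ 2)%N) z k x - (n.+1 ^ 2)%:R * m) /
  (n.+1 ^ 2)%:R) ^+ 2)%:E.
have mS n : measurable_fun [set: T] (fun x => \sum_(k < n) z k x).
  exact: measurable_sum.
have gE n x : g n x = (((n.+1%:R ^+ 2) ^+ 2)^-1%:E *
    ((\sum_(k < (n.+1 ^ 2)%N) z k x - (n.+1 ^ 2)%:R * m) ^+ 2)%:E)%E.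
  by rewrite /g -EFinM natrX exprMn exprVn mulrC.
have gi n : (\int[P]_x g n x <= (2 * l%:R * v / n.+1%:R ^+ 2)%:E)%E.
  under eq_integral do rewrite gE.
  rewrite ge0_integralZl_EFin//.
  - apply: (@le_trans _ _ (((n.+1%:R ^+ 2) ^+ 2)^-1%:E *
      (2 * (n.+1 ^ 2)%:R * l%:R * v)%:E)%E).
      by apply: lee_wpmul2l; [rewrite lee_fin|exact: centered_second_moment_le].
    rewrite -EFinM lee_fin natrX le_eqVlt; apply/orP; left; apply/eqP.
    have : n.+1%:R != 0 :> R by rewrite pnatr_eq0.
    by move: (n.+1%:R : R) => a a0; field.
  - by move=> x _; rewrite lee_fin sqr_ge0.
  - by apply/measurable_EFinP; apply: measurable_funX; exact: measurable_funB.
have : {ae P, forall x, forall e : R, 0 < e -> \forall n \near \oo, (g n x <= e%:E)%E}.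
  apply: ae_cvg0_of_series.
  - move=> n; apply/measurable_EFinP; apply: measurable_funX.
    by apply: measurable_funM => //; exact: measurable_funB.
  - by move=> n x; rewrite lee_fin sqr_ge0.
  - apply: le_lt_trans (@nneseries_inv_sqr_lty _ (2 * l%:R * v) _); last first.
      by rewrite !mulr_ge0.
    by apply: lee_nneseries => // n _ _; apply: integral_ge0 => x _; rewrite lee_fin sqr_ge0.
apply: filterS => x gx; apply: (@cvg_average_of_squares _ (fun k => z k x)) => //.
apply/cvgrPdist_le => e e0.
have := gx (e ^+ 2) (exprn_gt0 _ e0).
apply: filterS => n; rewrite lee_fin => H.
rewrite -(@ler_pXn2r _ 2)// ?nnegrE// ?(ltW e0)// real_normK ?num_real//.
apply: le_trans H; rewrite le_eqVlt; apply/orP; left; apply/eqP.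
rewrite -sqrrN; congr (_ ^+ 2).
have : (n.+1 ^ 2)%:R != 0 :> R by rewrite natrX expf_neq0// pnatr_eq0.
by move: (_ ^ 2)%:R (\sum_(_ < _) _) => a b a0; field.
Qed.

(** * Increments of Brownian motion *)

Section brownian_increments.
Context d (T : measurableType d) (R : realType) (P : probability T R).
Variable W : R -> {RV P >-> R}.
Hypothesis W_bm : standard_brownian_motion W.

Let D (s t : R) (w : T) : R := W t w - W s w.

Let mD s t : measurable_fun [set: T] (D s t).
Proof. by apply: measurable_funB; exact: measurable_funPT. Qed.

Lemma brownian_increments_indep (s t u v : R) : 0 <= s -> s <= t -> t <= u ->
  u <= v -> forall A B, measurable A -> measurable B ->
  P ((fun w => W t w - W s w) @^-1` A `&` (fun w => W v w - W u w) @^-1` B) =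
  (P ((fun w => W t w - W s w)%R @^-1` A) *
   P ((fun w => W v w - W u w)%R @^-1` B))%E.
Proof.
move=> s0 st tu uv A B mA mB.
(* Three consecutive increments, over [s, t], [t, u] and [u, v]. The middle one is left free by
   taking [setT] as its event. *)
pose tm (i : nat) : R := match i with 0 => s | 1 => t | 2 => u | _ => v end.
have tm_nd : {homo tm : i j / (i <= j)%N >-> i <= j}.
  have lev i : tm i <= v.
    by case: i => [|[|[|?]]] //=; [exact: le_trans st (le_trans tu uv)|exact: le_trans tu uv].
  case=> [|[|[|i]]] [|[|[|j]]] //= _.
  - exact: le_trans tu.
  - exact: lev 0%N.
  - exact: lev 1%N.
pose B3 (i : 'I_3) : set R := match val i with 0 => A | 1 => setT | _ => B end.
have mB3 i : measurable (B3 i) by rewrite /B3; case: i => [[|[|?]] ?] //=.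
have := @bm_indep _ _ _ _ _ W_bm 3 tm s0 tm_nd B3 mB3.
rewrite !big_ord_recr big_ord0 /= mul1e /B3 /= preimage_setT.
rewrite [X in (_ * X * _)%E](_ : _ = 1%E); last exact: probability_setT.
rewrite mule1 => <-; congr (P _).
apply/seteqP; split=> w /=.
- by move=> [wA wB] i _; case: i => [[|[|[|?]]] ?] //=.
- move=> h; split; first exact: (h (@Ordinal 3 0 isT)).
  exact: (h (@Ordinal 3 2 isT)).
Qed.

Let lawD (s t : R) : 0 <= s -> s < t -> forall A : set R, measurable A ->
  P (D s t @^-1` A) = normal_prob 0 (Num.sqrt (t - s)) A.
Proof. by move=> s0 st A mA; exact: (bm_gauss W_bm). Qed.

Let sqrtB (s t : R) : s < t -> 0 < Num.sqrt (t - s).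
Proof. by move=> st; rewrite sqrtr_gt0 subr_gt0. Qed.

(** The windows overlap when l > 1, but windows starting at least l steps apart are independent, so
    l is also the range of dependence. All l are wanted because the polarization of lag products
    combines three successive values of l. *)
Lemma ae_quadratic_variation (h : R) (l : nat) : 0 < h -> (0 < l)%N ->
  {ae P, forall w, (\sum_(k < N) (W ((k + l)%:R * h) w - W (k%:R * h) w) ^+ 2) /
    N%:R @[N --> \oo] --> l%:R * h}.
Proof.
move=> h0 l0.
have lh0 : 0 < l%:R * h by rewrite mulr_gt0// ltr0n.
have sub k : (k + l)%:R * h - k%:R * h = l%:R * h by rewrite natrD; ring.
have ge0 k : 0 <= k%:R * h by rewrite mulr_ge0// ltW.
have lt k : k%:R * h < (k + l)%:R * h by rewrite -subr_gt0 sub.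
have le_kh i j : (i <= j)%N -> i%:R * h <= j%:R * h.
  by move=> ij; rewrite ler_wpM2r ?ler_nat// ltW.
have e2 k : (\int[P]_x (D (k%:R * h) ((k + l)%:R * h) x ^+ 2)%:E = (l%:R * h)%:E)%E.
  rewrite (@expectation_gaussian_sqr _ _ _ P _ _ (mD _ _) (sqrtB _ _ (lt k)))//.
    by rewrite sqr_sqrtr sub// ltW.
  exact: lawD.
have e4 k : (\int[P]_x (D (k%:R * h) ((k + l)%:R * h) x ^+ 4)%:E <= (2 ^+ 15 * (l%:R * h) ^+ 2)%:E)%E.
  apply: (le_trans (@expectation_gaussian_pow4 _ _ _ P _ _ (mD _ _) (sqrtB _ _ (lt k)) _)).
    exact: lawD.
  by rewrite (exprM _ 2 2) sqr_sqrtr sub// ltW.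
apply: (@ae_cvg_average _ _ _ P
  (fun k w => (W ((k + l)%:R * h) w - W (k%:R * h) w) ^+ 2)
  (l%:R * h) (2 ^+ 15 * (l%:R * h) ^+ 2) l) => //.
- by move=> k; apply: measurable_funX; exact: mD.
- by move=> k x; exact: sqr_ge0.
- by rewrite mulr_ge0// sqr_ge0.
- move=> k j kj.
  rewrite (@ge0_expectation_prod _ _ _ P (D (k%:R * h) ((k + l)%:R * h))
    (D (j%:R * h) ((j + l)%:R * h)) (fun y => y ^+ 2) (fun y => y ^+ 2))//.
  + by rewrite !e2 -EFinM lee_fin expr2.
  + move=> A B mA mB; apply: brownian_increments_indep => //.
    * exact/ltW/lt.
    * exact: le_kh.
    * exact/ltW/lt.
  + by move=> y; exact: sqr_ge0.
  + by move=> y; exact: sqr_ge0.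
  + by rewrite e2 ltry.
- by move=> k; under eq_integral do rewrite -exprM; exact: e4.
Qed.

Lemma ae_dyadic_quartic_variation (h : R) : 0 < h ->
  {ae P, forall w, exists m0, forall m j, (m0 <= m)%N ->
    \sum_(k < (2 ^ (m + j))%N) (W (k.+1%:R * (h / 2 ^+ j)) w - W (k%:R * (h / 2 ^+ j)) w) ^+ 4
    <= 2 ^+ (m + j) * (2 ^+ 16 * (h / 2 ^+ j) ^+ 2)}.
Proof.
move=> h0.
pose hj j : R := h / 2 ^+ j.
have hj0 j : 0 < hj j by rewrite divr_gt0// exprn_gt0.
pose z j k w := (W (k.+1%:R * hj j) w - W (k%:R * hj j) w) ^+ 4.
have z0 j k w : 0 <= z j k w by rewrite /z (exprM _ 2 2) sqr_ge0.
have mz j k : measurable_fun [set: T] (z j k) by apply: measurable_funX; exact: mD.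
have ge0 j k : 0 <= k%:R * hj j by rewrite mulr_ge0// ltW.
have sub j k : k.+1%:R * hj j - k%:R * hj j = hj j by rewrite -natr1; ring.
have lt j k : k%:R * hj j < k.+1%:R * hj j by rewrite -subr_gt0 sub.
have e4 j k : (\int[P]_x (z j k x)%:E <= (2 ^+ 15 * hj j ^+ 2)%:E)%E.
  apply: (le_trans (@expectation_gaussian_pow4 _ _ _ P _ _ (mD _ _) (sqrtB _ _ (lt j k)) _)).
    exact: lawD.
  by rewrite (exprM _ 2 2) sqr_sqrtr sub// ltW.
have e8 j k : (\int[P]_x (z j k x ^+ 2)%:E <= (2 ^+ 15 * hj j ^+ 4)%:E)%E.
  under eq_integral do rewrite -exprM.
  apply: (le_trans (@expectation_gaussian_pow8 _ _ _ P _ _ (mD _ _) (sqrtB _ _ (lt j k)) _)).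
    exact: lawD.
  by rewrite (exprM _ 2 4) sqr_sqrtr sub// ltW.
(* The fourth moment is not computed. What matters is that it does not depend on k, which its
   expression through the density shows. *)
have ezpdf j k : (\int[P]_x (z j k x)%:E =
    \int[lebesgue_measure]_y (y ^+ 4 * normal_pdf 0 (Num.sqrt (hj j)) y)%:E)%E.
  apply: (@ge0_expectation_gaussian _ _ _ P (D (k%:R * hj j) (k.+1%:R * hj j))
    (Num.sqrt (hj j)) (mD _ _) _ (fun y => y ^+ 4)).
  - by move=> A mA; have := lawD _ _ (ge0 j k) (lt j k) _ mA; rewrite sub.
  - exact: measurable_funX.
  - by move=> y; rewrite (exprM _ 2 2) sqr_ge0.
pose m4 j := fine (\int[P]_x (z j 0%N x)%:E)%E.
have ez j k : (\int[P]_x (z j k x)%:E = (m4 j)%:E)%E.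
  rewrite /m4 fineK; last first.
    rewrite ge0_fin_numE; first exact: le_lt_trans (e4 _ _) (ltry _).
    by apply: integral_ge0 => x _; rewrite lee_fin.
  by rewrite !ezpdf.
have m40 j : 0 <= m4 j.
  by rewrite fine_ge0// integral_ge0// => x _; rewrite lee_fin.
have m4le j : m4 j <= 2 ^+ 15 * hj j ^+ 2 by rewrite -lee_fin -(ez j 0%N).
pose S j n w := \sum_(k < n) z j k w.
have mS j n : measurable_fun [set: T] (S j n) by exact: measurable_sum.
(* Normalized so that a value at most 1 means a deviation of at most 2^(m+j) h_j^2. With 2^(m+j)
   terms its expectation is at most 2^16 / 2^(m+j), geometric in both m and j. *)
pose g j m w := (((S j (2 ^ (m + j))%N w - (2 ^ (m + j))%:R * m4 j) /
   ((2 ^ (m + j))%:R * hj j ^+ 2)) ^+ 2)%:E.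
have g0 j m w : (0 <= g j m w)%E by rewrite lee_fin sqr_ge0.
have mg j m : measurable_fun [set: T] (g j m).
  apply/measurable_EFinP; apply: measurable_funX; apply: measurable_funM => //.
  exact: measurable_funB.
have gi j m : (\int[P]_x g j m x <= (2 ^+ 17 / (2 ^ m)%:R / (2 ^ j.+1)%:R)%:E)%E.
  pose c : R := ((2 ^ (m + j))%:R * hj j ^+ 2).
  have c0 : 0 < c by rewrite mulr_gt0 ?exprn_gt0// ltr0n expn_gt0.
  have gE x : g j m x = ((c ^+ 2)^-1%:E *
      ((S j (2 ^ (m + j))%N x - (2 ^ (m + j))%:R * m4 j) ^+ 2)%:E)%E.
    by rewrite /g -/c -EFinM exprMn exprVn mulrC.
  under eq_integral do rewrite gE.
  rewrite ge0_integralZl_EFin//.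
  - apply: (@le_trans _ _ ((c ^+ 2)^-1%:E *
       (2 * (2 ^ (m + j))%:R * 1%:R * (2 ^+ 15 * hj j ^+ 4))%:E)%E).
      apply: lee_wpmul2l; first by rewrite lee_fin invr_ge0 sqr_ge0.
      apply: (@centered_second_moment_le _ _ _ P (z j) (m4 j) (2 ^+ 15 * hj j ^+ 4) 1) => //.
        by rewrite mulr_ge0// exprn_ge0// ltW.
      move=> k i; rewrite addn1 => ki.
      rewrite (@ge0_expectation_prod _ _ _ P (D (k%:R * hj j) (k.+1%:R * hj j))
        (D (i%:R * hj j) (i.+1%:R * hj j)) (fun y => y ^+ 4) (fun y => y ^+ 4))//.
      + by rewrite !ez -EFinM lee_fin expr2.
      + move=> A B mA mB; apply: brownian_increments_indep => //.
        * exact/ltW/lt.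
        * by rewrite ler_wpM2r ?ler_nat// ltW.
        * exact/ltW/lt.
      + by move=> y; rewrite (exprM _ 2 2) sqr_ge0.
      + by move=> y; rewrite (exprM _ 2 2) sqr_ge0.
      + by rewrite ez ltry.
    rewrite -EFinM lee_fin le_eqVlt; apply/orP; left; apply/eqP; rewrite /c.
    rewrite expnD expnS natrM [(2 * _)%:R]natrM.
    have : hj j != 0 by rewrite gt_eqF.
    have : (2 ^ m)%:R != 0 :> R by rewrite pnatr_eq0 expn_eq0.
    have : (2 ^ j)%:R != 0 :> R by rewrite pnatr_eq0 expn_eq0.
    move: (hj j) (2 ^ m)%:R (2 ^ j)%:R => a b e ? ? ?.
    by rewrite (exprS (2 : R) 16) (exprS (2 : R) 15); move: ((2 : R) ^+ 15) => K; field; do ?[apply/andP; split].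
  - by move=> x _; rewrite lee_fin sqr_ge0.
  - by apply/measurable_EFinP; apply: measurable_funX; exact: measurable_funB.
  - by rewrite invr_ge0 sqr_ge0.
(* Summing over the levels before letting m grow makes a single threshold [m0] serve all j, since
   each [g j m] is at most [G m]. *)
pose G m w := (\sum_(0 <= j <oo) g j m w)%E.
have : {ae P, forall x, forall e : R, 0 < e -> \forall n \near \oo, (G n x <= e%:E)%E}.
  apply: ae_cvg0_of_series.
  - by move=> m; apply: ge0_emeasurable_sum.
  - by move=> m x; apply: nneseries_ge0.
  - apply: (@le_lt_trans _ _ (\sum_(0 <= m <oo) (2 ^+ 18 / (2 ^ m.+1)%:R)%:E)%E); last first.
      by apply: (le_lt_trans (epsilon_trick0 _ _)); rewrite ?ltry// exprn_ge0.
    apply: lee_nneseries => [m _ _|m _].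
      by apply: integral_ge0 => x _; exact: nneseries_ge0.
    rewrite integral_nneseries//.
    apply: (@le_trans _ _ (\sum_(0 <= j <oo) (2 ^+ 17 / (2 ^ m)%:R / (2 ^ j.+1)%:R)%:E)%E).
      by apply: lee_nneseries => // j _ _; exact: integral_ge0.
    apply: (le_trans (epsilon_trick0 _ _)).
      by rewrite divr_ge0// exprn_ge0.
    rewrite lee_fin expnS natrM (exprS _ 17) le_eqVlt; apply/orP; left; apply/eqP.
    have : (2 ^ m)%:R != 0 :> R by rewrite pnatr_eq0 expn_eq0.
    by move: (2 ^ m)%:R ((2 : R) ^+ 17) => a K ?; field.
apply: filterS => w Gw; have [m0 _ H] := Gw _ ltr01.
exists m0 => m j m0m; have {H} Gm := H m m0m.
have gm : (g j m w <= 1%:E)%E.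
  apply: le_trans Gm; apply: le_trans (nneseries_lim_ge j.+1 _) => //.
  rewrite big_nat_recr//= -[leLHS]add0e leeD//; exact: sume_ge0.
have c0 : 0 < (2 ^ (m + j))%:R * hj j ^+ 2 by rewrite mulr_gt0 ?exprn_gt0// ltr0n expn_gt0.
move: gm; rewrite lee_fin => gm.
have {gm} : S j (2 ^ (m + j))%N w - (2 ^ (m + j))%:R * m4 j <= (2 ^ (m + j))%:R * hj j ^+ 2.
  rewrite -[leRHS]mul1r -ler_pdivrMr//; move: gm.
  by move: (_ / _) => q; nra.
rewrite lerBlDr natrX => H; apply: (le_trans H).
rewrite -mulrDr ler_wpM2l ?exprn_ge0// (exprS _ 15).
(* Mean at most 2^15 h_j^2 plus deviation at most h_j^2: together below 2^16 h_j^2. *)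
have := m4le j; have : 1 * hj j ^+ 2 <= 2 ^+ 15 * hj j ^+ 2.
  by rewrite ler_wpM2r ?sqr_ge0// exprn_ege1// ler1n.
rewrite -/(hj j); lra.
Qed.

End brownian_increments.

(** * Averages along an autoregression *)

Section cesaro.
Context (R : realType).
Implicit Types (f g u : nat -> R) (c e : R).

Lemma cvg_contraction0 (b : R) u (r : nat -> R) : 0 <= b < 1 ->
  (forall n, 0 <= u n) -> (\forall n \near \oo, u n.+1 <= b * u n + r n) ->
  r n @[n --> \oo] --> 0 -> u n @[n --> \oo] --> 0.
Proof.
move=> /andP[b0 b1] u0 [N1 _ ue] /cvgrPdist_le e0.
apply/cvgrPdist_le => d d0.
(* Errors of this size, propagated with ratio b, add up to at most d / 2. *)
have d2 : 0 < d * (1 - b) / 2 by rewrite divr_gt0// mulr_gt0// subr_gt0.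
have [N2 _ eN2] := e0 _ d2.
pose N := maxn N1 N2.
have uN k : u (N + k)%N <= b ^+ k * u N + d / 2.
  elim: k => [|k IH]; first by rewrite addn0 expr0 mul1r lerDl; lra.
  rewrite addnS; apply: (le_trans (ue _ _)); first by rewrite /= /N; lia.
  have : `|0 - r (N + k)%N| <= d * (1 - b) / 2 by apply: eN2; rewrite /= /N; lia.
  rewrite sub0r normrN => /ler_normlW eNk.
  apply: (@le_trans _ _ (b * (b ^+ k * u N + d / 2) + d * (1 - b) / 2)).
    by rewrite lerD// ler_wpM2l.
  by rewrite exprS; lra.
have /cvgrPdist_le bk : (fun k => b ^+ k * u N) @ \oo --> (0 : R).
  rewrite -(mul0r (u N)); apply: cvgMr_tmp.
  by apply: cvg_expr; rewrite ger0_norm.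
have d2' : 0 < d / 2 by lra.
have [K _ hK] := bk _ d2'.
exists (N + K)%N => // n /= Kn.
have -> : n = (N + (n - N))%N by lia.
rewrite sub0r normrN ger0_norm//; apply: (le_trans (uN _)).
have : `|0 - b ^+ (n - N) * u N| <= d / 2 by apply: hK; rewrite /=; lia.
by rewrite sub0r normrN => /ler_normlW; lra.
Qed.

Definition average f (N : nat) : R := (\sum_(k < N) f k) / N%:R.

Lemma average_cvgP f c : average f @ \oo --> c <->
  forall e, 0 < e -> \forall N \near \oo,
    `|\sum_(k < N) f k - N%:R * c| <= e * N%:R.
Proof.
have key N e : (0 < N)%N -> (`|c - average f N| <= e) =
    (`|\sum_(k < N) f k - N%:R * c| <= e * N%:R).
  move=> N0; have N0' : 0 < N%:R :> R by rewrite ltr0n.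
  rewrite distrC /average.
  have -> : (\sum_(k < N) f k) / N%:R - c = (\sum_(k < N) f k - N%:R * c) / N%:R.
    by rewrite mulrBl mulrAC divff ?gt_eqF// mul1r.
  by rewrite normrM normfV (gtr0_norm N0') ler_pdivrMr.
split=> [/cvgrPdist_le fc e /fc|fc].
  by apply: filterS2 (nbhs_infty_gt 0) => N N0; rewrite key.
apply/cvgrPdist_le => e /fc.
by apply: filterS2 (nbhs_infty_gt 0) => N N0; rewrite key.
Qed.

Lemma cvg_average_ext f g c : (forall k, f k = g k) ->
  average f @ \oo --> c -> average g @ \oo --> c.
Proof. by move=> fg; rewrite (_ : f = g)//; exact/funext. Qed.

(** Shifting changes the centred sum by the fixed amounts [f 0] and [c], negligible against N. *)
Lemma cvg_average_shift f c : average f @ \oo --> c ->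
  average (fun k => f k.+1) @ \oo --> c.
Proof.
move=> /average_cvgP fc; apply/average_cvgP => e e0.
have e4 : 0 < e / 4 by lra.
have [M _ hM] := fc _ e4.
exists (maxn M (Num.truncn ((`|f 0%N| + `|c|) / (e / 4))).+1) => // N /=.
rewrite geq_max => /andP[MN fN].
have N1 : 1 <= N%:R :> R by rewrite ler1n; lia.
have {}fN : `|f 0%N| + `|c| <= e / 4 * N%:R.
  rewrite mulrC -ler_pdivrMr//; apply/ltW; apply: lt_le_trans (truncnS_gt _) _.
  by rewrite ler_nat.
have := hM N.+1 (leqW MN).
rewrite big_ord_recl/= => h.
under eq_bigr do rewrite -[X in f X]/(lift ord0 _ : nat).
have -> : \sum_(k < N) f (lift ord0 k) - N%:R * c =
  (f 0%N + \sum_(k < N) f (lift ord0 k) - N.+1%:R * c) - f 0%N + c.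
  by rewrite -natr1; ring.
apply: (le_trans (ler_normD _ _)); apply: (le_trans (lerD (ler_normB _ _) (lexx _))).
move: h; rewrite -natr1 mulrDr mulr1; nra.
Qed.

Lemma cvg_average_shiftn f c j : average f @ \oo --> c ->
  average (fun k => f (k + j)%N) @ \oo --> c.
Proof.
move=> fc; elim: j => [|j /cvg_average_shift].
  by apply: cvg_average_ext fc => k; rewrite addn0.
by apply: cvg_average_ext => k; rewrite addSnnS.
Qed.

Lemma cvg_averageD f g c c' : average f @ \oo --> c -> average g @ \oo --> c' ->
  average (fun k => f k + g k) @ \oo --> c + c'.
Proof.
move=> fc gc.
rewrite (_ : average _ = (fun N => average f N + average g N)); first exact: cvgD.
by apply/funext => N; rewrite /average big_split/= mulrDl.
Qed.

Lemma cvg_averageZ f c (a : R) : average f @ \oo --> c ->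
  average (fun k => a * f k) @ \oo --> a * c.
Proof.
move=> fc.
rewrite (_ : average _ = (fun N => a * average f N)); first exact: cvgMl_tmp.
by apply/funext => N; rewrite /average -mulr_sumr mulrA.
Qed.

End cesaro.

Arguments average {R} f N.

(** * The recursion Y(k+1) = a Y(k) + xi(k), with only lag averages of xi known *)

Section autoregression.
Context (R : realType) (w Y : nat -> R) (a h : R).
Hypothesis a01 : 0 <= a < 1.
Hypothesis h_ge0 : 0 <= h.
Hypothesis w_qv : forall l, (0 < l)%N ->
  average (fun k => (w (k + l)%N - w k) ^+ 2) @ \oo --> l%:R * h.
Hypothesis Y0 : Y 0%N = 0.
Hypothesis YS : forall k, Y k.+1 = a * Y k + (w k.+1 - w k).

Let xi k := w k.+1 - w k.

(** Polarization: twice the product of two distant increments is a second difference of squared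
    increments over longer windows. The averages of these squares are l h, linear in l, so their
    second difference vanishes. *)
Lemma average_lag_products l : (0 < l)%N ->
  average (fun k => xi k * xi (k + l)%N) @ \oo --> (0 : R).
Proof.
case: l => // l _.
pose Q l k := (w (k + l)%N - w k) ^+ 2.
have Qc i : average (Q i) @ \oo --> i%:R * h.
  case: i => [|i]; last exact: w_qv.
  rewrite mul0r; apply/average_cvgP => e e0; near=> N.
  rewrite big1 => [|k _]; last by rewrite /Q addn0 subrr expr0n.
  by rewrite mulr0 subrr normr0 mulr_ge0// ltW.
pose f k := 2^-1 * (Q l.+2 k + (-1 * Q l.+1 k + (-1 * Q l.+1 k.+1 + Q l k.+1))).
apply: (@cvg_average_ext _ f).
  move=> k; rewrite /f /Q /xi !addnS !addSn.
  move: (w _) (w k) (w _) (w _) => x1 x2 x3 x4; by field.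
rewrite [X in _ --> X](_ : _ = 2^-1 * (l.+2%:R * h + (-1 * (l.+1%:R * h) +
   (-1 * (l.+1%:R * h) + l%:R * h)))); last first.
  by rewrite -[l.+2%:R]natr1 -[l.+1%:R]natr1; ring.
apply: cvg_averageZ; apply: cvg_averageD; first exact: Qc.
apply: cvg_averageD; first by apply: cvg_averageZ; exact: Qc.
apply: cvg_averageD.
  by apply: cvg_averageZ; apply: (cvg_average_shift _ (Q l.+1)); exact: Qc.
by apply: (cvg_average_shift _ (Q l)); exact: Qc.
Unshelve. all: end_near. Qed.

Let xi2 : average (fun k => xi k ^+ 2) @ \oo --> h.
Proof.
rewrite -[h]mul1r; apply: cvg_average_ext (w_qv 1 isT) => k.
by rewrite addn1.
Qed.

(** Convexity with weights a and 1 - a gives Y(k+1)^2 <= a Y(k)^2 + xi(k)^2 / (1 - a). Summing,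
    [Y 0 = 0] lets the shifted sum of squares dominate the unshifted one. *)
Lemma sum_sqr_ar_le N :
  \sum_(k < N) Y k ^+ 2 <= (\sum_(k < N) xi k ^+ 2) / (1 - a) ^+ 2.
Proof.
have /andP[a0 a1] := a01; have b0 : 0 < 1 - a by rewrite subr_gt0.
have step k : Y k.+1 ^+ 2 <= a * Y k ^+ 2 + xi k ^+ 2 / (1 - a).
  rewrite YS -/(xi k) -subr_ge0.
  have -> : a * Y k ^+ 2 + xi k ^+ 2 / (1 - a) - (a * Y k + xi k) ^+ 2 =
     a * ((1 - a) * Y k - xi k) ^+ 2 / (1 - a) by field; rewrite gt_eqF.
  by rewrite divr_ge0 ?(ltW b0)// mulr_ge0// sqr_ge0.
have mono : \sum_(k < N) Y k ^+ 2 <= \sum_(k < N) Y k.+1 ^+ 2.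
  have : \sum_(k < N) Y k ^+ 2 <= \sum_(k < N.+1) Y k ^+ 2.
    by rewrite big_ord_recr/= lerDl sqr_ge0.
  by rewrite big_ord_recl Y0 expr0n/= add0r.
have : \sum_(k < N) Y k.+1 ^+ 2 <=
    a * (\sum_(k < N) Y k ^+ 2) + (\sum_(k < N) xi k ^+ 2) / (1 - a).
  rewrite mulr_sumr mulr_suml -big_split/=.
  by apply: ler_sum => k _.
move=> H; have := le_trans mono H.
set A := \sum_(k < N) _; set B := \sum_(k < N) _ => AB.
rewrite expr2 invfM mulrA ler_pdivlMr//; lra.
Qed.

Let g j k := Y k * xi (k + j)%N.

(** The averages of Y(k) xi(k+j) have upper limit at most c in absolute value. All lags j are
    quantified together because the bound at lag j is improved using the one at lag j+1. *)
Let bounded c := forall j e, 0 < e -> \forall N \near \oo,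
  `|\sum_(k < N) g j k| <= (c + e) * N%:R.

Let C := (h + 1) / (1 - a) ^+ 2.

Let bounded0 : bounded C.
Proof.
have /andP[a0 a1] := a01; have b0 : 0 < 1 - a by rewrite subr_gt0.
move=> j e e0.
have /average_cvgP/(_ _ ltr01) X0 := xi2.
have /average_cvgP/(_ _ ltr01) Xj := cvg_average_shiftn _ _ _ j xi2.
apply: filterS2 X0 Xj => N /ler_normlW X0 /ler_normlW Xj.
have YN := sum_sqr_ar_le N.
apply: (@le_trans _ _ (2^-1 * (\sum_(k < N) Y k ^+ 2 + \sum_(k < N) xi (k + j)%N ^+ 2))).
  rewrite -big_split mulr_sumr/=; apply: (le_trans (ler_norm_sum _ _ _)).
  apply: ler_sum => k _; rewrite /g normrM.
  rewrite -(real_normK (num_real (Y k))) -(real_normK (num_real (xi _))).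
  by have := sqr_ge0 (`|Y k| - `|xi (k + j)%N|); lra.
have N0 : 0 <= N%:R :> R by [].
have B1 : 1 <= (1 - a) ^- 2 by rewrite -[leRHS]mul1r ler_pdivlMr ?exprn_gt0//; nra.
have : \sum_(k < N) Y k ^+ 2 <= C * N%:R.
  apply: (le_trans YN); rewrite /C mulrAC ler_wpM2r ?invr_ge0 ?sqr_ge0//; lra.
have : \sum_(k < N) xi (k + j)%N ^+ 2 <= C * N%:R.
  apply: (@le_trans _ _ ((h + 1) * N%:R)); first by lra.
  by rewrite ler_wpM2r// /C ler_peMr// addr_ge0.
have : 0 <= e * N%:R by rewrite mulr_ge0// ltW.
by rewrite mulrDl; lra.
Qed.

(** Y(k+1) xi(k+1+j) = a Y(k) xi(k+j+1) + xi(k) xi(k+j+1), and the last product averages to 0. *)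
Let bounded_step c : 0 <= c -> bounded c -> bounded (a * c).
Proof.
have /andP[a0 a1] := a01.
move=> c0 bc j e e0.
have e2 : 0 < e / 2 by lra.
have [N1 _ H1] := bc j.+1 _ e2.
have /average_cvgP/(_ _ e2)[N2 _ H2] := average_lag_products j.+1 isT.
exists (maxn N1 N2).+1 => // -[//|N] /=; rewrite ltnS geq_max => /andP[N1N N2N].
have {}H1 := H1 _ N1N; have := H2 _ N2N; rewrite mulr0 subr0 => {}H2.
rewrite big_ord_recl /g Y0 mul0r add0r.
have -> : \sum_(i < N) Y (lift ord0 i) * xi (lift ord0 i + j)%N =
    a * (\sum_(k < N) g j.+1 k) + \sum_(k < N) xi k * xi (k + j.+1)%N.
  rewrite mulr_sumr -big_split/=; apply: eq_bigr => k _.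
  by rewrite /bump leq0n add1n YS -/(xi k) /g addSnnS; ring.
apply: (le_trans (ler_normD _ _)); rewrite normrM ger0_norm//.
have {}H1 := ler_wpM2l a0 H1.
have ac0 : 0 <= a * c by rewrite mulr_ge0.
have eN : 0 <= e / 2 * N%:R by rewrite mulr_ge0// ltW.
have aeN : a * (e / 2 * N%:R) <= e / 2 * N%:R by rewrite ler_piMl// ltW.
rewrite -[N.+1%:R]natr1 (_ : (a * c + e) * (N%:R + 1) =
  a * ((c + e / 2) * N%:R) + e / 2 * N%:R +
  (e / 2 * N%:R - a * (e / 2 * N%:R)) + (a * c + e)); last by field.
lra.
Qed.

Lemma average_ar_cross : average (fun k => Y k * xi k) @ \oo --> (0 : R).
Proof.
have /andP[a0 a1] := a01; have b0 : 0 < 1 - a by rewrite subr_gt0.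
have C0 : 0 <= C by rewrite divr_ge0 ?sqr_ge0// addr_ge0.
have bn n : bounded (a ^+ n * C).
  elim: n => [|n IH]; first by rewrite expr0 mul1r; exact: bounded0.
  by rewrite exprS -mulrA; exact: bounded_step (mulr_ge0 (exprn_ge0 _ a0) C0) IH.
apply/average_cvgP => e e0.
have e2 : 0 < e / 2 by lra.
have /cvgrPdist_le/(_ _ e2)[n _ /(_ n (leqnn _))] : (fun n => a ^+ n * C) @ \oo --> (0 : R).
  rewrite -(mul0r C); apply: cvgMr_tmp.
  by apply: cvg_expr; rewrite ger0_norm.
rewrite sub0r normrN => /ler_normlW an.
apply: filterS (bn n 0%N _ e2) => N; rewrite mulr0 subr0.
under eq_bigr do rewrite /g addn0.
move=> /le_trans; apply; rewrite ler_wpM2r//; lra.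
Qed.

(** Squaring the recursion and summing gives A(N+1) = a^2 A(N) + 2 a G(N) + X(N), while v = a^2 v +
    h. Hence A(N) - N v is contracted by a^2 up to errors o(N). *)
Lemma average_ar_sqr : average (fun k => Y k ^+ 2) @ \oo --> h / (1 - a ^+ 2).
Proof.
have /andP[a0 a1] := a01.
have a2 : 0 < 1 - a ^+ 2 by nra.
set v := h / (1 - a ^+ 2).
have hv : h = v * (1 - a ^+ 2) by rewrite /v divfK// gt_eqF.
pose A N := \sum_(k < N) Y k ^+ 2.
pose G N := \sum_(k < N) Y k * xi k.
pose X N := \sum_(k < N) xi k ^+ 2.
have AS N : A N.+1 - N.+1%:R * v = a ^+ 2 * (A N - N%:R * v) +
    (2 * a * G N + (X N - N%:R * h) - v).
  have -> : A N.+1 = a ^+ 2 * A N + 2 * a * G N + X N.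
    rewrite /A big_ord_recl Y0 expr0n add0r /G /X !mulr_sumr -!big_split/=.
    by apply: eq_bigr => k _; rewrite /bump leq0n add1n YS -/(xi k); ring.
  by rewrite hv -natr1; ring.
pose u N := `|A N - N%:R * v| / N%:R.
suff : u N @[N --> \oo] --> (0 : R).
  move=> /cvgrPdist_le uc; apply/average_cvgP => e /uc.
  apply: filterS2 (nbhs_infty_gt 0) => N N0.
  have N0' : 0 < N%:R :> R by rewrite ltr0n.
  by rewrite sub0r normrN /u normrM normr_id normfV (gtr0_norm N0') ler_pdivrMr.
apply: (@cvg_contraction0 _ (a ^+ 2) _ (fun N => `|2 * a * G N + (X N - N%:R * h) - v| / N%:R)).
- by rewrite sqr_ge0/= -subr_gt0.
- by move=> n; rewrite /u divr_ge0.
- near=> N; have N0 : (0 < N)%N by near: N; exact: nbhs_infty_gt.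
  have N0' : 0 < N%:R :> R by rewrite ltr0n.
  rewrite /u AS [a ^+ 2 * (_ / _)]mulrA -[leRHS]mulrDl.
  apply: (@le_trans _ _ (`|a ^+ 2 * (A N - N%:R * v) + (2 * a * G N + (X N - N%:R * h) - v)| / N%:R)).
    by rewrite ler_wpM2l// lef_pV2 ?posrE ?ltr0n// ler_nat.
  rewrite ler_wpM2r ?invr_ge0//; apply: (le_trans (ler_normD _ _)).
  by rewrite normrM (ger0_norm (sqr_ge0 a)).
- apply/cvgrPdist_le => e e0.
  have e4 : 0 < e / 4 by lra.
  have /average_cvgP/(_ _ e4) H1 := average_ar_cross.
  have /average_cvgP/(_ _ e4) H2 := xi2.
  near=> N; have N0 : (0 < N)%N by near: N; exact: nbhs_infty_gt.
  have N0' : 0 < N%:R :> R by rewrite ltr0n.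
  rewrite sub0r normrN normrM normr_id normfV (gtr0_norm N0') ler_pdivrMr//.
  have H1' : `|G N - N%:R * 0| <= e / 4 * N%:R by near: N.
  rewrite mulr0 subr0 in H1'.
  have H2' : `|X N - N%:R * h| <= e / 4 * N%:R by near: N.
  have H3 : `|v| <= e / 4 * N%:R.
    rewrite mulrC -ler_pdivrMr//; near: N; exact: nbhs_infty_ger.
  apply: (le_trans (ler_normB _ _)); apply: (le_trans (lerD (ler_normD _ _) (lexx _))).
  rewrite [`|2 * a * _|]normrM [`|2 * a|]normrM (ger0_norm a0) (ger0_norm (_ : 0 <= 2))//.
  have : a * `|G N| <= `|G N| by rewrite ler_piMl// ltW.
  lra.
Unshelve. all: end_near. Qed.

End autoregression.

(** * Chaining *)

Lemma cvg_sum_ord (R : realType) N (F : nat -> nat -> R) (l : nat -> R) :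
  (forall k, F k n @[n --> \oo] --> l k) ->
  (\sum_(k < N) F k n) @[n --> \oo] --> \sum_(k < N) l k.
Proof.
move=> Fl; elim: N => [|N IH].
  by rewrite big_ord0; under eq_fun do rewrite big_ord0; exact: cvg_cst.
by rewrite big_ord_recr; under eq_fun do rewrite big_ord_recr; exact: cvgD.
Qed.

Lemma within_continuous_seq (R : realType) (f : R -> R) (A : set R)
    (u : nat -> R) (s : R) :
  {within A, continuous f} -> A s -> (forall n, A (u n)) ->
  u n @[n --> \oo] --> s -> f (u n) @[n --> \oo] --> f s.
Proof.
move=> /subspace_continuousP fA As Au us.
apply: cvg_comp (fA _ As) => B /=; rewrite /within /= => /us[N _ HN].
by exists N => // n /HN /(_ (Au n)).
Qed.

Lemma sum_geometric_le (R : realType) (q : R) J : 0 <= q < 1 ->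
  \sum_(j < J) q ^+ j <= (1 - q)^-1.
Proof.
move=> /andP[q0 q1]; have b0 : 0 < 1 - q by rewrite subr_gt0.
rewrite -[leRHS]mul1r ler_pdivlMr// mulrC -opprB mulNr -subrX1 opprB.
by rewrite gerBl exprn_ge0.
Qed.

(** Weighted Cauchy-Schwarz, 5 being the sum of the powers of 4/5. The induction rests on (z + x)^2
    <= 5 z^2 + (5/4) x^2, whose gap is (2 z - x/2)^2. *)
Lemma sqr_sum_le_weighted (R : realType) (b : nat -> R) J :
  (\sum_(j < J) b j) ^+ 2 <= 5 * \sum_(j < J) (5 / 4) ^+ j * b j ^+ 2.
Proof.
elim: J b => [|J IH] b; first by rewrite !big_ord0 expr0n mulr0.
rewrite !big_ord_recl expr0 mul1r mulrDr.
have := IH (fun j => b j.+1).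
have -> : \sum_(j < J) (5 / 4) ^+ lift ord0 j * b (lift ord0 j) ^+ 2 =
    5 / 4 * \sum_(j < J) (5 / 4) ^+ j * b j.+1 ^+ 2.
  by rewrite mulr_sumr; apply: eq_bigr => j _; rewrite lift0 exprS mulrA.
rewrite [X in (_ + X) ^+ 2](eq_bigr (fun j : 'I_J => b j.+1)) => [|j _]; last by rewrite lift0.
move: (\sum_(j < J) b j.+1) (\sum_(j < J) _ * _) (b ord0) => x y z H.
have := sqr_ge0 (2 * z - x / 2); lra.
Qed.

Section chaining.
Context (R : realType) (w : R -> R) (h C : R) (m0 : nat).
Hypothesis h_gt0 : 0 < h.
Hypothesis C_ge0 : 0 <= C.
Hypothesis w_cont : {within `[0, +oo[, continuous w}.

Let inc j k := w (k.+1%:R * (h / 2 ^+ j)) - w (k%:R * (h / 2 ^+ j)).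

Hypothesis inc4 : forall m j, (m0 <= m)%N ->
  \sum_(k < (2 ^ (m + j))%N) inc j k ^+ 4 <= 2 ^+ (m + j) * (C * (h / 2 ^+ j) ^+ 2).

(** Left index of the level j dyadic interval of block k used to approximate s. Refining from k,
    rather than rounding s down, keeps the right end of the block inside block k, and each
    refinement moves by at most one increment of [w]. *)
Fixpoint dyadic_floor (s : R) (k j : nat) : nat :=
  if j is j'.+1 then
    let p := (dyadic_floor s k j').*2 in
    if s < p.+1%:R * (h / 2 ^+ j) then p else p.+1
  else k.

Let hS j : h / 2 ^+ j = 2 * (h / 2 ^+ j.+1).
Proof. by rewrite exprS; field; rewrite expf_neq0. Qed.

Let hj0 j : 0 < h / 2 ^+ j.
Proof. by rewrite divr_gt0// exprn_gt0. Qed.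

Lemma dyadic_floor_itv s k j : k%:R * h <= s <= k.+1%:R * h ->
  (dyadic_floor s k j)%:R * (h / 2 ^+ j) <= s <=
  (dyadic_floor s k j).+1%:R * (h / 2 ^+ j).
Proof.
move=> sk; elim: j => [|j /andP[IH1 IH2]]; first by rewrite /= expr0 divr1.
rewrite /=; move: IH1 IH2; rewrite (hS j).
set p := dyadic_floor s k j; set t := h / 2 ^+ j.+1 => IH1 IH2.
have E1 : p%:R * (2 * t) = p.*2%:R * t by rewrite -muln2 natrM; ring.
have E2 : p.+1%:R * (2 * t) = p.*2.+2%:R * t.
  by rewrite -doubleS -muln2 natrM; ring.
by case: ltP => H; apply/andP; split; rewrite -?E1 -?E2// ltW.
Qed.

Lemma dyadic_floor_block s k j :
  (k * 2 ^ j <= dyadic_floor s k j < k.+1 * 2 ^ j)%N.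
Proof.
elim: j => [|j IH]; first by rewrite expn0 !muln1 /= leqnn ltnSn.
rewrite /= expnS; case: ifP => _; move: IH; rewrite !(mulnCA _ 2); lia.
Qed.

Let step s k j := w ((dyadic_floor s k j.+1)%:R * (h / 2 ^+ j.+1)) -
  w ((dyadic_floor s k j)%:R * (h / 2 ^+ j)).

(** The step is 0 or one increment whose index depends on s. The sum over the whole block dominates
    every possibility, so the right side no longer involves s. *)
Lemma dyadic_step_pow4_le s k j : step s k j ^+ 4 <=
  \sum_(k * 2 ^ j.+1 <= i < k.+1 * 2 ^ j.+1) inc j.+1 i ^+ 4.
Proof.
have inc0 i : 0 <= inc j.+1 i ^+ 4 by rewrite (exprM _ 2 2) sqr_ge0.
rewrite /step; have E : (dyadic_floor s k j)%:R * (h / 2 ^+ j) =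
    (dyadic_floor s k j).*2%:R * (h / 2 ^+ j.+1).
  by rewrite (hS j) -muln2 natrM; ring.
rewrite {}E /=; case: ifP => _.
  by rewrite subrr expr0n; exact: sumr_ge0.
have := dyadic_floor_block s k j; set p := dyadic_floor s k j => pk.
rewrite -/(inc j.+1 p.*2).
have pk2 : (k * 2 ^ j.+1 <= p.*2 < k.+1 * 2 ^ j.+1)%N.
  by move: pk; rewrite expnS !(mulnCA _ 2); lia.
rewrite (@big_cat_nat _ _ _ p.*2)/=; [|by case/andP: pk2|by case/andP: pk2 => _ /ltnW].
rewrite [X in _ + X]big_ltn; last by case/andP: pk2.
by rewrite addrCA lerDl addr_ge0// sumr_ge0.
Qed.

Lemma dyadic_chaining_le N J (s : nat -> R) : (2 ^ m0 <= N)%N ->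
  \sum_(k < N) (w ((dyadic_floor (s k) k J)%:R * (h / 2 ^+ J)) - w (k%:R * h)) ^+ 2
  <= N%:R * ((15 + 40 * C) * h).
Proof.
move=> mN.
(* The quartic bound is available for 2^m blocks only. Rounding N up to a power of 2 costs a factor
   2. *)
have [m /andP[m0m /andP[Nm mN2]]] : exists m, (m0 <= m)%N && (N <= 2 ^ m <= 2 * N)%N.
  have N0 : (0 < N)%N by apply: leq_trans mN; rewrite expn_gt0.
  exists (up_log 2 N); apply/and3P; split.
  - rewrite -(@leq_exp2l 2)//; apply: (leq_trans mN); exact: up_logP.
  - exact: up_logP.
  - have [->|N1] := eqVneq N 1%N; first by rewrite up_log1.
    have N2 : (1 < N)%N by lia.
    have := @up_log_gtn 2 N isT N2; case: (up_log 2 N) => [|u]; first by rewrite expn0; lia.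
    by rewrite expnS /=; lia.
(* AM-GM with weights c j: the ratio 2/3 makes both (5/4) * (2/3) and
   (5/4) * (3/2) * (1/2) smaller than 1. *)
have q0 : 0 <= 5 / 4 :> R by lra.
pose c j : R := h * (2 / 3) ^+ j.
have c0 j : 0 < c j by rewrite mulr_gt0// exprn_gt0//; lra.
pose B k j := \sum_(k * 2 ^ j.+1 <= i < k.+1 * 2 ^ j.+1) inc j.+1 i ^+ 4.
have one k : (w ((dyadic_floor (s k) k J)%:R * (h / 2 ^+ J)) - w (k%:R * h)) ^+ 2 <=
    5 / 2 * \sum_(j < J) (5 / 4) ^+ j * (c j + B k j / c j).
  have -> : w ((dyadic_floor (s k) k J)%:R * (h / 2 ^+ J)) - w (k%:R * h) =
      \sum_(j < J) step (s k) k j.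
    elim: J => [|J' IH]; first by rewrite big_ord0 /= expr0 divr1 subrr.
    by rewrite big_ord_recr -IH /step /=; ring.
  apply: (le_trans (sqr_sum_le_weighted _ _ _)).
  rewrite -mulrA ler_wpM2l//.
  rewrite mulr_sumr; apply: ler_sum => j _.
  rewrite [leRHS]mulrCA; apply: ler_wpM2l; first exact: exprn_ge0.
  have := dyadic_step_pow4_le (s k) k j; rewrite -/(B k j) => H.
  apply: (@le_trans _ _ (2^-1 * (c j + step (s k) k j ^+ 4 / c j))).
    rewrite -subr_ge0.
    have -> : 2^-1 * (c j + step (s k) k j ^+ 4 / c j) - step (s k) k j ^+ 2 =
      (c j - step (s k) k j ^+ 2) ^+ 2 / (2 * c j) by field; rewrite gt_eqF.
    by rewrite divr_ge0 ?sqr_ge0// mulr_ge0// ltW.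
  by rewrite ler_wpM2l// lerD2l ler_wpM2r// invr_ge0 ltW.
apply: (@le_trans _ _ (\sum_(k < N) (5 / 2 * \sum_(j < J) (5 / 4) ^+ j * (c j + B k j / c j)))).
  by apply: ler_sum.
rewrite -mulr_sumr exchange_big/=.
have BN j : \sum_(k < N) B k j <= N%:R * (C * h ^+ 2 * 2^-1 ^+ j).
  have inc0 i : 0 <= inc j.+1 i ^+ 4 by rewrite (exprM _ 2 2) sqr_ge0.
  have -> : \sum_(k < N) B k j = \sum_(0 <= i < N * 2 ^ j.+1) inc j.+1 i ^+ 4.
    by rewrite big_nat_mul big_mkord.
  apply: (@le_trans _ _ (\sum_(0 <= i < 2 ^ (m + j.+1)) inc j.+1 i ^+ 4)).
    rewrite [leRHS](@big_cat_nat _ _ _ (N * 2 ^ j.+1))//=; last by rewrite expnD leq_mul2r Nm orbT.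
    by rewrite lerDl sumr_ge0.
  rewrite big_mkord; apply: (le_trans (inc4 _ _ m0m)).
  have -> : 2 ^+ (m + j.+1) * (C * (h / 2 ^+ j.+1) ^+ 2) =
     2 ^+ m / 2 * (C * h ^+ 2 * 2^-1 ^+ j).
    rewrite exprD exprVn exprS; have : (2 : R) ^+ j != 0 by rewrite expf_neq0.
    by move: (2 ^+ m) (2 ^+ j) => x y y0; field.
  apply: ler_wpM2r; first by rewrite !mulr_ge0 ?sqr_ge0 ?exprn_ge0 ?invr_ge0 ?(ltW h_gt0).
  by rewrite ler_pdivrMr// -natrX -natrM ler_nat mulnC.
have inner j : \sum_(k < N) (5 / 4) ^+ j * (c j + B k j / c j) <=
    N%:R * h * ((5 / 6) ^+ j + C * (15 / 16) ^+ j).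
  rewrite -mulr_sumr big_split/= -[X in _ + X]mulr_suml sumr_const card_ord -[_ *+ N]mulr_natl.
  apply: (@le_trans _ _ ((5 / 4) ^+ j * (N%:R * c j + N%:R * (C * h ^+ 2 * 2^-1 ^+ j) / c j))).
    apply: ler_wpM2l; first exact: exprn_ge0.
    by rewrite lerD2l ler_wpM2r ?invr_ge0 ?(ltW (c0 j)).
  rewrite /c le_eqVlt; apply/orP; left; apply/eqP.
  rewrite (_ : 5 / 6 = 5 / 4 * (2 / 3) :> R); last by field.
  rewrite (_ : 15 / 16 = 5 / 4 * 2^-1 / (2 / 3) :> R); last by field.
  rewrite (exprMn j (5 / 4) (2 / 3)) (exprMn j (5 / 4 * 2^-1)) (exprMn j (5 / 4) 2^-1).
  rewrite (exprVn (2 / 3) j).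
  have : (2 / 3 : R) ^+ j != 0 by rewrite expf_neq0//; apply/eqP; lra.
  move: ((2 / 3) ^+ j) (2^-1 ^+ j) ((5 / 4) ^+ j) => x y z x0; field.
  by rewrite x0 gt_eqF.
(* 6 and 16 are the sums of the geometric series of ratios 5/6 and 15/16; with the factor 5/2 they
   give 15 + 40 C. *)
apply: (@le_trans _ _ (5 / 2 * (N%:R * h * (6 + C * 16)))); last first.
  by rewrite le_eqVlt; apply/orP; left; apply/eqP; field.
rewrite ler_wpM2l//.
apply: (@le_trans _ _ (\sum_(j < J) N%:R * h * ((5 / 6) ^+ j + C * (15 / 16) ^+ j))).
  by apply: ler_sum.
rewrite -mulr_sumr ler_wpM2l ?mulr_ge0 ?(ltW h_gt0)// big_split/= -mulr_sumr.
have := @sum_geometric_le R (5 / 6) J ltac:(lra).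
have := @sum_geometric_le R (15 / 16) J ltac:(lra).
have -> : (1 - 15 / 16)^-1 = 16 :> R by field.
have -> : (1 - 5 / 6)^-1 = 6 :> R by field.
by move=> g1 g2; rewrite lerD// ler_wpM2l.
Qed.

(** The chaining bound is uniform in the depth J, and continuity of [w] lets J tend to infinity. *)
Lemma block_oscillation_le N (s : nat -> R) : (2 ^ m0 <= N)%N ->
  (forall k, k%:R * h <= s k <= k.+1%:R * h) ->
  \sum_(k < N) (w (s k) - w (k%:R * h)) ^+ 2 <= N%:R * ((15 + 40 * C) * h).
Proof.
move=> mN sk.
pose u k J := (dyadic_floor (s k) k J)%:R * (h / 2 ^+ J).
have us k : u k J @[J --> \oo] --> s k.
  apply/cvgrPdist_le => e e0.
  have /cvgrPdist_le/(_ _ e0) : (fun J => h * 2^-1 ^+ J) @ \oo --> (0 : R).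
    rewrite -(mulr0 h); apply: cvgMl_tmp; apply: cvg_expr.
    by rewrite ger0_norm//; lra.
  apply: filterS => J; rewrite sub0r normrN exprVn => /ler_normlW H.
  have /andP[H1 H2] := dyadic_floor_itv (s k) k J (sk k).
  rewrite ger0_norm; last by rewrite subr_ge0.
  apply: le_trans H; rewrite lerBlDl /u; apply: (le_trans H2).
  by rewrite -natr1 mulrDl mul1r.
have wu k : (w (u k J) - w (k%:R * h)) ^+ 2 @[J --> \oo] --> (w (s k) - w (k%:R * h)) ^+ 2.
  apply: (@cvg_comp _ _ _ (fun J => w (u k J) - w (k%:R * h)) (fun x : R => x ^+ 2)); last exact: exprn_continuous.
  apply: cvgB; last exact: cvg_cst.
  apply: (within_continuous_seq _ _ _ _ _ w_cont) => //=.
  - rewrite in_itv/= andbT; have /andP[+ _] := sk k; apply: le_trans.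
    by rewrite mulr_ge0// ltW.
  - by move=> n; rewrite in_itv/= andbT /u mulr_ge0// ltW.
have := cvg_sum_ord _ N _ _ wu.
move=> /cvg_lim => /(_ (@Rhausdorff R)) <-; apply: limr_le.
  by apply/cvg_ex; eexists; exact: cvg_sum_ord wu.
by near=> J; exact: dyadic_chaining_le.
Unshelve. all: end_near. Qed.

End chaining.

(** * Comparison of the path with the Euler chain *)

Section path_comparison.
Context (R : realType) (x w : R -> R) (theta h : R) (Y : nat -> R).
Hypothesis theta_gt0 : 0 < theta.
Hypothesis h_gt0 : 0 < h.
Hypothesis thetah : theta * h <= 1 / 4.
Hypothesis x_cont : {within `[0, +oo[, continuous x}.
Hypothesis x0 : x 0 = 0.
Hypothesis sde : forall t : R, 0 <= t -> x t = x 0 +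
  \int[lebesgue_measure]_(s in `[0, t]) (- theta * x s) + (w t - w 0).
Hypothesis Y0 : Y 0%N = 0.
Hypothesis YS : forall k, Y k.+1 = (1 - theta * h) * Y k +
  (w (k.+1%:R * h) - w (k%:R * h)).

(** The drift is compared with that of the constant c. With c the value of x at the left end of a
    block, this serves both the oscillation within the block and one Euler step. *)
Lemma sde_increment_le (u v c o : R) : 0 <= u -> u <= v ->
  (forall s, u <= s <= v -> `|x s - c| <= o) ->
  `|x v - x u - (w v - w u) + theta * (v - u) * c| <= theta * (v - u) * o.
Proof.
move=> u0 uv xo.
have v0 : 0 <= v by exact: le_trans uv.
have ci : lebesgue_measure.-integrable `[0, v] (EFin \o (fun s => - theta * x s)).
  apply: continuous_compact_integrable; first exact: segment_compact.
  move=> s; apply: cvgMl_tmp.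
  apply: (continuous_subspaceW _ x_cont) => t /=.
  by rewrite !in_itv/= => /andP[-> _].
have -> : x v - x u - (w v - w u) =
    \int[lebesgue_measure]_(s in `]u, v]) (- theta * x s).
  rewrite -(@Rintegral_itvB _ _ (BLeft 0) (BRight v) u)//.
  by rewrite (sde v)// (sde u)//; ring.
have mu_uv : fine (lebesgue_measure `]u, v]%classic) = v - u.
  rewrite lebesgue_measure_itv/= lte_fin; case: ltP => // vu.
  by rewrite (@le_anti _ _ u v) ?subrr// uv vu.
have ci' : lebesgue_measure.-integrable `]u, v] (EFin \o (fun s => - theta * x s)).
  apply: integrableS ci => //= t; rewrite /= !in_itv/= => /andP[ut ->].
  by rewrite andbT ltW// (le_lt_trans u0).
have cc (a : R) : lebesgue_measure.-integrable `]u, v] (EFin \o (fun=> a)).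
  have ccv : lebesgue_measure.-integrable `[u, v] (EFin \o (fun=> a)).
    by apply: continuous_compact_integrable;
      [exact: segment_compact|move=> s; exact: cvg_cst].
  apply: integrableS ccv => //= t; rewrite /= !in_itv/= => /andP[ut ->].
  by rewrite andbT ltW.
have bound (s : R) : `]u, v]%classic s -> - theta * (c + o) <= - theta * x s <= - theta * (c - o).
  rewrite /= in_itv/= => /andP[us sv].
  have : `|x s - c| <= o by apply: xo; rewrite (ltW us).
  rewrite ler_distl => /andP[h1 h2].
  by rewrite !mulNr !lerN2 !ler_pM2l// h1 h2.
have I1 : - theta * (c + o) * (v - u) <= \int[lebesgue_measure]_(s in `]u, v]) (- theta * x s).
  rewrite -mu_uv -Rintegral_cst//; apply: le_Rintegral => // s su.
  by have /andP[] := bound s su.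
have I2 : \int[lebesgue_measure]_(s in `]u, v]) (- theta * x s) <= - theta * (c - o) * (v - u).
  rewrite -mu_uv -Rintegral_cst//; apply: le_Rintegral => // s su.
  by have /andP[] := bound s su.
move: I1 I2; move: (\int[lebesgue_measure]_(s in `]u, v]) (- theta * x s)) => J.
move=> {ci ci' cc bound mu_uv} I1 I2.
by rewrite ler_norml; apply/andP; split; lra.
Qed.

Let xk k := x (k%:R * h).

(** A maximizer turns the oscillation of x over a block into a value at one point, where the
    increment of w can be controlled by chaining. *)
Lemma block_argmax k : exists s, k%:R * h <= s <= k.+1%:R * h /\
  forall t, k%:R * h <= t <= k.+1%:R * h -> `|x t - xk k| <= `|x s - xk k|.
Proof.
have kk : k%:R * h <= k.+1%:R * h by rewrite ler_wpM2r ?(ltW h_gt0)// ler_nat.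
have k0 : 0 <= k%:R * h by rewrite mulr_ge0// ltW.
have [|s sk H] := @EVT_max R (fun t => `|x t - xk k|) _ _ kk.
  move=> t; apply: (@cvg_norm R^o); apply: cvgB; last exact: cvg_cst.
  apply: (continuous_subspaceW _ x_cont) => z /=.
  by rewrite !in_itv/= andbT => /andP[/(le_trans k0)].
exists s; split => [|t tk]; first by move: sk; rewrite in_itv.
by apply: H; rewrite in_itv.
Qed.

Lemma block_approximation : exists s D : nat -> R,
  [/\ forall k, k%:R * h <= s k <= k.+1%:R * h,
      forall k t, k%:R * h <= t <= k.+1%:R * h -> (x t - Y k) ^+ 2 <= D k &
      forall N, \sum_(k < N) D k <=
        160 * \sum_(k < N) (w (s k) - w (k%:R * h)) ^+ 2 +
        160 * (theta * h) ^+ 2 * \sum_(k < N) Y k ^+ 2].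
Proof.
have [s sP] := choice block_argmax.
pose o k := `|x (s k) - xk k|.
pose r k := `|w (s k) - w (k%:R * h)|.
pose e k := xk k - Y k.
pose g k := 2 * r k + 2 * (theta * h) * `|Y k|.
have th0 : 0 < theta * h by rewrite mulr_gt0.
have th2 : theta * h <= 4^-1 by move: thetah; lra.
have k0 k : 0 <= k%:R * h by rewrite mulr_ge0// ltW.
have o0 k : 0 <= o k by exact: normr_ge0.
have r0 k : 0 <= r k by exact: normr_ge0.
(* At the maximizer o <= r + theta h (|Y| + |e|) + o / 4. The last term is absorbed, with factor 4/3
   rounded up to 2. *)
have ok k : o k <= g k + 2 * (theta * h) * `|e k|.
  have [/andP[s1 s2] sm] := sP k.
  have H : `|x (s k) - xk k - (w (s k) - w (k%:R * h)) + theta * (s k - k%:R * h) * xk k|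
      <= theta * (s k - k%:R * h) * o k.
    apply: sde_increment_le => // t /andP[t1 t2].
    by apply: sm; rewrite t1 (le_trans t2).
  have sh : 0 <= s k - k%:R * h <= h.
    by rewrite subr_ge0 s1/= lerBlDl; move: s2; rewrite -natr1; lra.
  have ts0 : 0 <= theta * (s k - k%:R * h).
    by case/andP: sh => sh0 _; rewrite mulr_ge0// ltW.
  have ts : theta * (s k - k%:R * h) <= theta * h.
    by case/andP: sh => _ sh1; rewrite ler_wpM2l// ltW.
  have xY : `|xk k| <= `|Y k| + `|e k|.
    by rewrite [xk k](_ : _ = Y k + e k) ?ler_normD// /e; ring.
  have : o k <= `|x (s k) - xk k - (w (s k) - w (k%:R * h)) + theta * (s k - k%:R * h) * xk k|
      + r k + theta * (s k - k%:R * h) * `|xk k|.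
    rewrite /o [in leLHS](_ : x (s k) - xk k = (x (s k) - xk k - (w (s k) - w (k%:R * h)) +
      theta * (s k - k%:R * h) * xk k) + (w (s k) - w (k%:R * h)) - theta * (s k - k%:R * h) * xk k); last by ring.
    apply: (le_trans (ler_normB _ _)); apply: (le_trans (lerD (ler_normD _ _) (lexx _))).
    by rewrite [`|theta * _ * xk k|]normrM (ger0_norm ts0).
  have a1 : theta * (s k - k%:R * h) * `|xk k| <= theta * h * (`|Y k| + `|e k|).
    by apply: ler_pM.
  have a2 : theta * (s k - k%:R * h) * o k <= 4^-1 * o k.
    by rewrite ler_wpM2r// (le_trans ts).
  have := r0 k.
  have : 0 <= theta * h * (`|Y k| + `|e k|).
    by rewrite mulr_ge0 ?(ltW th0)// addr_ge0.
  rewrite /g; move: H a1 a2.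
  move: `|x (s k) - xk k - _ + _| `|xk k| (o k) (r k) `|Y k| `|e k| => A B O Q y z.
  by move: (theta * (s k - k%:R * h)) (theta * h) => p q; lra.
(* Within a block |x - Y| <= o + |e|, and theta h <= 1/4 turns the bound on o into g + |e| / 2. *)
exists s, (fun k => (g k + 3 / 2 * `|e k|) ^+ 2).
have g0 k : 0 <= g k by rewrite addr_ge0// !mulr_ge0// ltW.
split=> [k|k t tk|N]; first by have [] := sP k.
  have [_ sm] := sP k.
  rewrite -(real_normK (num_real (x t - Y k))) lerXn2r ?nnegrE//.
    by rewrite addr_ge0// mulr_ge0.
  rewrite [x t - Y k](_ : _ = (x t - xk k) + e k); last by rewrite /e; ring.
  apply: (le_trans (ler_normD _ _)).
  have := sm t tk; rewrite -/(o k) => H.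
  have := ok k; have : 2 * (theta * h) * `|e k| <= 2^-1 * `|e k|.
    by rewrite ler_wpM2r//; lra.
  lra.
have q1 : 0 <= 1 - theta * h / 2 by lra.
have eS k : `|e k.+1| <= (1 - theta * h / 2) * `|e k| + theta * h * g k.
  have [_ sm] := sP k.
  have := @sde_increment_le (k%:R * h) (k.+1%:R * h) (xk k) (o k) (k0 k).
  have -> : k.+1%:R * h - k%:R * h = h by rewrite -natr1; ring.
  have kk : k%:R * h <= k.+1%:R * h by rewrite ler_wpM2r ?(ltW h_gt0)// ler_nat.
  move=> /(_ kk sm) H.
  rewrite [e k.+1](_ : _ = (1 - theta * h) * e k + (x (k.+1%:R * h) - x (k%:R * h) -
    (w (k.+1%:R * h) - w (k%:R * h)) + theta * h * xk k)); last first.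
    by rewrite /e YS /xk; ring.
  apply: (le_trans (ler_normD _ _)); rewrite normrM (ger0_norm (_ : 0 <= 1 - theta * h)); last by lra.
  apply: (@le_trans _ _ ((1 - theta * h) * `|e k| + theta * h * (g k + 2 * (theta * h) * `|e k|))).
    by rewrite lerD2l (le_trans H)// ler_wpM2l// ltW.
  have : theta * h * (2 * (theta * h) * `|e k|) <= theta * h * (2^-1 * `|e k|).
    by rewrite ler_wpM2l ?(ltW th0)// ler_wpM2r//; lra.
  lra.
(* Convexity of the square with weights 1 - theta h / 2 and theta h / 2, at the points |e| and 2 g.
   Summed over k, the factors theta h / 2 cancel, so the bound does not degrade with time or with
   small h. *)
have e2S k : e k.+1 ^+ 2 <= (1 - theta * h / 2) * e k ^+ 2 + theta * h / 2 * (4 * g k ^+ 2).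
  apply: (@le_trans _ _ (((1 - theta * h / 2) * `|e k| + theta * h * g k) ^+ 2)).
    rewrite -(real_normK (num_real (e k.+1))) lerXn2r ?nnegrE//.
    by apply: addr_ge0; apply: mulr_ge0 => //; exact: ltW.
  rewrite -(real_normK (num_real (e k))) -subr_ge0.
  have -> : (1 - theta * h / 2) * `|e k| ^+ 2 + theta * h / 2 * (4 * g k ^+ 2) -
    ((1 - theta * h / 2) * `|e k| + theta * h * g k) ^+ 2 =
    (1 - theta * h / 2) * (theta * h / 2) * (`|e k| - 2 * g k) ^+ 2 by field.
  by rewrite mulr_ge0 ?sqr_ge0// mulr_ge0//; lra.
have E : \sum_(k < N) e k ^+ 2 <= 4 * \sum_(k < N) g k ^+ 2.
  have e0 : e 0%N = 0 by rewrite /e /xk mul0r x0 Y0 subrr.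
  have E1 : \sum_(k < N) e k ^+ 2 <= \sum_(k < N) e k.+1 ^+ 2.
    have : \sum_(k < N) e k ^+ 2 <= \sum_(k < N.+1) e k ^+ 2.
      by rewrite big_ord_recr/= lerDl sqr_ge0.
    by rewrite big_ord_recl e0 expr0n/= add0r.
  have E2 : \sum_(k < N) e k.+1 ^+ 2 <= (1 - theta * h / 2) * (\sum_(k < N) e k ^+ 2) +
      theta * h / 2 * (4 * \sum_(k < N) g k ^+ 2).
    by rewrite !mulr_sumr -big_split/=; apply: ler_sum => k _; rewrite e2S.
  have th3 : 0 < theta * h / 2 by lra.
  rewrite -(ler_pM2l th3); move: (\sum_(k < N) e k ^+ 2) E1 E2 => A E1 E2; lra.
(* 20 = 2 + (9/2) * 4; then g^2 <= 8 r^2 + 8 (theta h)^2 Y^2 gives 160. *)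
apply: (@le_trans _ _ (20 * \sum_(k < N) g k ^+ 2)).
  apply: (@le_trans _ _ (\sum_(k < N) (2 * g k ^+ 2 + 9 / 2 * e k ^+ 2))).
    apply: ler_sum => k _; rewrite -(real_normK (num_real (e k))).
    by have := sqr_ge0 (g k - 3 / 2 * `|e k|); lra.
  by rewrite big_split/= -!mulr_sumr; lra.
rewrite !mulr_sumr -big_split/=; apply: ler_sum => k _.
rewrite -(real_normK (num_real (w _ - _))) -(real_normK (num_real (Y k))).
have := sqr_ge0 (2 * r k - 2 * (theta * h) * `|Y k|); rewrite /g -/(r k); lra.
Qed.

End path_comparison.

(** * Sampling *)

Lemma big_nat_blocks (R : realType) (b : nat -> nat) (f : nat -> R) K :
  {homo b : i j / (i <= j)%N} ->
  \sum_(b 0%N <= i < b K) f i = \sum_(k < K) \sum_(b k <= i < b k.+1) f i.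
Proof.
move=> bm; elim: K => [|K IH]; first by rewrite big_ord0 big_geq.
by rewrite big_ord_recr -IH (@big_cat_nat _ _ _ (b K))//; exact: bm.
Qed.

Section sampling.
Context (R : realType) (x : R -> R) (Y D : nat -> R) (h v B : R).
Hypothesis h_gt0 : 0 < h.
Hypothesis B_ge0 : 0 <= B.
Hypothesis D_block : forall k t, k%:R * h <= t <= k.+1%:R * h ->
  (x t - Y k) ^+ 2 <= D k.
Hypothesis Y_average : average (fun k => Y k ^+ 2) @ \oo --> v.
Hypothesis D_average : exists N0, forall N, (N0 <= N)%N ->
  \sum_(k < N) D k <= N%:R * B.

(** A block of length h contains H = h / dt samples up to 1, and the n samples span Q = n dt / h
    blocks. Sample values in block k are replaced by Y(k), at a cost measured by D(k). *)
Lemma sampled_average_bounds_fixed (dt e : R) n : 0 < dt -> 0 < e <= 1 ->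
  3 / e <= h / dt -> 3 / e <= n%:R * dt / h ->
  (forall N, (Num.truncn (n%:R * dt / h) <= N)%N ->
    `|\sum_(k < N) Y k ^+ 2 - N%:R * v| <= e * N%:R /\
    \sum_(k < N) D k <= N%:R * B) -> e <= v ->
  (1 - e) ^+ 2 * (v - e) - 2 * B / e <=
  (\sum_(1 <= i < n.+1) x (i%:R * dt) ^+ 2) / n%:R <=
  (1 + e) ^+ 2 * (v + e) + 4 * B / e.
Proof.
move=> dt0 /andP[e0 e1] H3 Q3 YD ev.
set H := h / dt in H3; set Q := n%:R * dt / h in Q3 YD.
have e3 : 3 <= 3 / e by rewrite ler_pdivlMr//; lra.
have H0 : 0 < H by lra.
have Q0 : 0 < Q by lra.
have nHQ : n%:R = H * Q by rewrite /H /Q; field; rewrite !gt_eqF.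
have Hdt : H * dt = h by rewrite /H divfK// gt_eqF.
clearbody H Q.
have n0 : 0 < n%:R :> R by rewrite nHQ mulr_gt0.
have eH : 3 <= e * H by move: H3; rewrite ler_pdivrMr//; lra.
have eQ : 3 <= e * Q by move: Q3; rewrite ler_pdivrMr//; lra.
have [t tE] : exists t : nat -> nat, forall k, t k = Num.truncn (k%:R * H).
  by exists (fun k => Num.truncn (k%:R * H)).
have kH0 k : 0 <= k%:R * H by rewrite mulr_ge0// ltW.
have tle k : (t k)%:R <= k%:R * H by rewrite tE truncn_le.
have tgt k : k%:R * H < (t k)%:R + 1 by rewrite tE natr1 truncnS_gt.
(* Block k owns the samples i with k H < i <= (k+1) H, so [b 0 = 1] matches the first index of the
   sum. *)
have [b bE] : exists b : nat -> nat, forall k, b k = (t k).+1.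
  by exists (fun k => (t k).+1).
have bm : {homo b : i j / (i <= j)%N}.
  by move=> i j ij; rewrite !bE ltnS !tE; apply: le_truncn; rewrite ler_wpM2r ?ler_nat// ltW.
have b0 : b 0%N = 1%N by rewrite bE tE mul0r truncn0.
have b1 k : (1 <= b k)%N by rewrite bE.
have cnt k : H - 1 <= (b k.+1 - b k)%:R <= H + 1.
  rewrite natrB; last exact: bm.
  have := tle k; have := tle k.+1; have := tgt k; have := tgt k.+1.
  rewrite !bE -!natr1 => *; apply/andP; split; lra.
have D0 k : 0 <= D k.
  apply: le_trans (sqr_ge0 _) (D_block k (k%:R * h) _).
  by rewrite lexx ler_wpM2r ?(ltW h_gt0)// ler_nat.
have xb k i : (b k <= i < b k.+1)%N -> (x (i%:R * dt) - Y k) ^+ 2 <= D k.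
  rewrite !bE => /andP[ki ik]; apply: D_block.
  rewrite -Hdt !mulrA !ler_pM2r//; apply/andP; split.
    apply/ltW; apply: (lt_le_trans (tgt k)); rewrite natr1 ler_nat.
    exact: ki.
  by apply: le_trans (tle k.+1); rewrite ler_nat -ltnS.
(* From X^2 <= (1 + e) Y^2 + (1 + 1/e) (X - Y)^2 and 1 + 1/e <= 2/e. *)
have ub k : \sum_(b k <= i < b k.+1) x (i%:R * dt) ^+ 2 <=
    (H + 1) * ((1 + e) * Y k ^+ 2 + 2 / e * D k).
  have U0 : 0 <= (1 + e) * Y k ^+ 2 + 2 / e * D k.
    by apply: addr_ge0; apply: mulr_ge0; rewrite ?sqr_ge0//; [lra|rewrite divr_ge0// ltW].
  apply: (@le_trans _ _ (\sum_(b k <= i < b k.+1) ((1 + e) * Y k ^+ 2 + 2 / e * D k))).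
    apply: ler_sum_nat => i ki; have := xb k i ki.
    move: (x _) (Y k) (D k) => X y z H'.
    have : (1 + e) / e * (X - y) ^+ 2 <= 2 / e * z.
      by apply: ler_pM; rewrite ?sqr_ge0 ?divr_ge0 ?addr_ge0 ?(ltW e0)// ler_wpM2r ?invr_ge0 ?(ltW e0)//; lra.
    have : 0 <= (e * y - (X - y)) ^+ 2 / e by rewrite divr_ge0 ?sqr_ge0// ltW.
    have -> : (e * y - (X - y)) ^+ 2 / e = (1 + e) * y ^+ 2 + (1 + e) / e * (X - y) ^+ 2 - X ^+ 2.
      by field; rewrite gt_eqF.
    lra.
  rewrite sumr_const_nat -[leLHS]mulr_natl ler_wpM2r//.
  by case/andP: (cnt k).
have lb k : (H - 1) * ((1 - e) * Y k ^+ 2) - (H + 1) * (D k / e) <=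
    \sum_(b k <= i < b k.+1) x (i%:R * dt) ^+ 2.
  apply: (@le_trans _ _ (\sum_(b k <= i < b k.+1) ((1 - e) * Y k ^+ 2 - D k / e))).
    rewrite sumr_const_nat -[leRHS]mulr_natl mulrBr; case/andP: (cnt k) => c1 c2.
    apply: lerB; apply: ler_wpM2r => //.
      by rewrite mulr_ge0 ?sqr_ge0// subr_ge0.
    by rewrite divr_ge0// ltW.
  apply: ler_sum_nat => i ki; have := xb k i ki.
  move: (x _) (Y k) (D k) (D0 k) => X y z z0 H'.
  have : (1 - e) / e * (X - y) ^+ 2 <= z / e.
    rewrite mulrAC ler_wpM2r ?invr_ge0 ?(ltW e0)//.
    have : (1 - e) * (X - y) ^+ 2 <= (X - y) ^+ 2 by rewrite ler_piMl ?sqr_ge0//; lra.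
    lra.
  have : 0 <= (e * y + (X - y)) ^+ 2 / e by rewrite divr_ge0 ?sqr_ge0// ltW.
  have -> : (e * y + (X - y)) ^+ 2 / e = X ^+ 2 - (1 - e) * y ^+ 2 + (1 - e) / e * (X - y) ^+ 2.
    by field; rewrite gt_eqF.
  lra.
have f0 i : 0 <= x (i%:R * dt) ^+ 2 by exact: sqr_ge0.
set K := Num.truncn Q in YD.
have KQ : K%:R <= Q by rewrite truncn_le ltW.
have QK : Q < K.+1%:R by exact: truncnS_gt.
clearbody K.
(* Rounding in both the samples per block and the number of blocks costs only a factor 1 + e or 1 -
   e, because e H and e Q are at least 3. The lower bound uses the K full blocks, the upper bound
   one more to cover all samples. *)
have He2 : (H + 1) * (Q + 1) <= (1 + e) * (H * Q) by nra.
have He3 : (1 - e) * (H * Q) <= (H - 1) * (Q - 1) by nra.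
apply/andP; split.
- have bKn : (b K <= n.+1)%N.
    rewrite bE ltnS -(ler_nat R); apply: (le_trans (tle K)).
    by rewrite nHQ mulrC ler_wpM2l// ltW.
  have [] := YD K (leqnn _); rewrite ler_norml => /andP[YK _] DK.
  rewrite ler_pdivlMr//.
  apply: (@le_trans _ _ (\sum_(b 0%N <= i < b K) x (i%:R * dt) ^+ 2)); last first.
    by rewrite b0 [leRHS](@big_cat_nat _ _ _ (b K))//= lerDl sumr_ge0.
  rewrite big_nat_blocks//.
  apply: (@le_trans _ _ (\sum_(k < K) ((H - 1) * ((1 - e) * Y k ^+ 2) - (H + 1) * (D k / e)))); last by apply: ler_sum.
  rewrite big_split/= sumrN -!mulr_sumr -mulr_suml.
  have Y1 : K%:R * (v - e) <= \sum_(k < K) Y k ^+ 2 by lra.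
  have D1 : (H + 1) * ((\sum_(k < K) D k) / e) <= n%:R * (2 * B / e).
    rewrite mulrA [n%:R * _]mulrA ler_wpM2r ?invr_ge0 ?(ltW e0)//.
    apply: (@le_trans _ _ ((H + 1) * (K%:R * B))); first by rewrite ler_wpM2l//; lra.
    rewrite !mulrA ler_wpM2r// nHQ.
    apply: (@le_trans _ _ ((H + 1) * (Q + 1))); first by rewrite ler_wpM2l//; lra.
    apply: (le_trans He2); rewrite [leRHS]mulrC ler_wpM2r ?mulr_ge0 ?(ltW H0) ?(ltW Q0)//; lra.
  have Y2 : n%:R * ((1 - e) ^+ 2 * (v - e)) <= (H - 1) * ((1 - e) * \sum_(k < K) Y k ^+ 2).
    apply: (@le_trans _ _ ((H - 1) * ((1 - e) * (K%:R * (v - e))))); last first.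
      apply: ler_wpM2l; first by lra.
      by apply: ler_wpM2l => //; lra.
    rewrite (_ : (H - 1) * _ = ((H - 1) * K%:R) * ((1 - e) * (v - e))); last by ring.
    rewrite (_ : n%:R * _ = ((1 - e) * n%:R) * ((1 - e) * (v - e))); last by ring.
    rewrite ler_wpM2r ?mulr_ge0 ?subr_ge0// nHQ.
    apply: (le_trans He3); rewrite ler_wpM2l ?subr_ge0//; first by nra.
    by move: QK; rewrite -natr1; lra.
  lra.
- have nbK : (n.+1 <= b K.+1)%N.
    by rewrite bE ltnS tE truncn_ge_nat// nHQ mulrC ler_wpM2r// ltW.
  have [] := YD K.+1 (leqnSn _); rewrite ler_norml => /andP[_ YK] DK.
  rewrite ler_pdivrMr//.
  apply: (@le_trans _ _ (\sum_(b 0%N <= i < b K.+1) x (i%:R * dt) ^+ 2)).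
    by rewrite b0 [leRHS](@big_cat_nat _ _ _ n.+1)//= lerDl sumr_ge0.
  rewrite big_nat_blocks//.
  apply: (@le_trans _ _ (\sum_(k < K.+1) ((H + 1) * ((1 + e) * Y k ^+ 2 + 2 / e * D k)))).
    by apply: ler_sum.
  rewrite -mulr_sumr big_split/= -!mulr_sumr.
  apply: (@le_trans _ _ ((H + 1) * (K.+1%:R * ((1 + e) * (v + e) + 2 / e * B)))).
    rewrite ler_wpM2l//; first by lra.
    rewrite mulrDr lerD//.
      by rewrite mulrCA ler_wpM2l//; lra.
    by rewrite mulrCA ler_wpM2l// divr_ge0// ltW.
  apply: (@le_trans _ _ ((1 + e) * n%:R * ((1 + e) * (v + e) + 2 / e * B))).
    rewrite mulrA ler_wpM2r//.
      by rewrite addr_ge0 ?mulr_ge0 ?divr_ge0//; lra.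
    rewrite nHQ; apply: le_trans He2; rewrite ler_wpM2l//; first by lra.
    by rewrite -natr1 lerD2r.
  rewrite (_ : (1 + e) * n%:R * _ = ((1 + e) ^+ 2 * (v + e) + (1 + e) * (2 * B / e)) * n%:R); last by ring.
  rewrite ler_wpM2r// lerD2l (_ : 4 * B / e = 2 * (2 * B / e)); last by ring.
  by rewrite ler_wpM2r ?divr_ge0 ?mulr_ge0 ?(ltW e0)//; lra.
Qed.

Variable Delta : nat -> R.
Hypothesis Delta_gt0 : forall n : nat, (1 <= n)%N -> 0 < Delta n.
Hypothesis Delta_cvg : Delta n @[n --> \oo] --> (0 : R).
Hypothesis T_cvg : n%:R * Delta n @[n --> \oo] --> +oo.

Lemma sampled_average_bounds (e : R) : 0 < e <= 1 -> e <= v ->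
  \forall n \near \oo,
  (1 - e) ^+ 2 * (v - e) - 2 * B / e <=
  (\sum_(1 <= i < n.+1) x (i%:R * Delta n) ^+ 2) / n%:R <=
  (1 + e) ^+ 2 * (v + e) + 4 * B / e.
Proof.
move=> e01 ev; have /andP[e0 e1] := e01.
have [N0 DN] := D_average.
have /average_cvgP/(_ _ e0)[N1 _ YN] := Y_average.
have he : 0 < e * h / 3 by rewrite divr_gt0// mulr_gt0.
move/cvgrPdist_le : Delta_cvg => /(_ _ he) Dsmall.
move/cvgryPge : T_cvg => Tbig.
near=> n.
have n0 : (0 < n)%N by near: n; exact: nbhs_infty_gt.
have dt0 : 0 < Delta n by exact: Delta_gt0.
apply: sampled_average_bounds_fixed => //.
- have : `|0 - Delta n| <= e * h / 3 by near: n.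
  rewrite sub0r normrN gtr0_norm// => H.
  rewrite ler_pdivrMr// mulrAC ler_pdivlMr//; lra.
- rewrite ler_pdivlMr//; near: n; exact: Tbig.
- move=> N TN.
  have NN : (maxn N0 N1 <= N)%N.
    apply: leq_trans TN; rewrite truncn_ge_nat; last first.
      by rewrite divr_ge0 ?mulr_ge0 ?(ltW dt0) ?(ltW h_gt0).
    rewrite ler_pdivlMr//; near: n; exact: Tbig.
  split; last by apply: DN; exact: leq_trans (leq_maxl _ _) NN.
  by apply: YN; exact: leq_trans (leq_maxr _ _) NN.
Unshelve. all: end_near. Qed.

End sampling.

Fixpoint autoregression (R : realType) (a : R) (u : nat -> R) (k : nat) : R :=
  if k is k'.+1 then a * autoregression R a u k' + (u k - u k') else 0.

Lemma cvg_sampled_average (R : realType) (x w : R -> R) (theta C : R)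
    (Delta : nat -> R) :
  0 < theta -> 0 <= C ->
  {within `[0, +oo[, continuous x} -> {within `[0, +oo[, continuous w} ->
  x 0 = 0 ->
  (forall t : R, 0 <= t -> x t = x 0 +
    \int[lebesgue_measure]_(s in `[0, t]) (- theta * x s) + (w t - w 0)) ->
  (forall m l, (0 < l)%N ->
    average (fun k => (w ((k + l)%:R * m.+1%:R^-1) - w (k%:R * m.+1%:R^-1)) ^+ 2)
      @ \oo --> (l%:R * m.+1%:R^-1 : R)) ->
  (forall m, exists m0, forall m' j, (m0 <= m')%N ->
    \sum_(k < (2 ^ (m' + j))%N) (w (k.+1%:R * (m.+1%:R^-1 / 2 ^+ j)) -
      w (k%:R * (m.+1%:R^-1 / 2 ^+ j))) ^+ 4
    <= 2 ^+ (m' + j) * (C * (m.+1%:R^-1 / 2 ^+ j) ^+ 2)) ->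
  (forall n : nat, (1 <= n)%N -> 0 < Delta n) ->
  Delta n @[n --> \oo] --> (0 : R) ->
  n%:R * Delta n @[n --> \oo] --> +oo ->
  (\sum_(1 <= i < n.+1) x (i%:R * Delta n) ^+ 2) / n%:R @[n --> \oo] -->
  (2 * theta)^-1.
Proof.
move=> theta0 C0 xc wc x0 sde qv quartic Dp Dc Tc.
apply/cvgrPdist_le => eta eta0.
set v0 : R := (2 * theta)^-1.
have v00 : 0 < v0 by rewrite invr_gt0 mulr_gt0.
have tv0 : theta * v0 = 2^-1 by rewrite /v0; field; rewrite gt_eqF.
clearbody v0.
have w0 : 0 < 3 * v0 + 12 by lra.
have [Kc KcE] : exists K, K = 160 * (15 + 40 * C) + 160 * theta ^+ 2 * (2 * v0 + 1) by eexists.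
have Kc0 : 0 <= Kc.
  rewrite KcE.
  by apply: addr_ge0; apply: mulr_ge0; rewrite ?mulr_ge0 ?sqr_ge0//; lra.
(* 3 v0 + 12 is the first-order coefficient of (1 + 3 e) (v0 + 2 e) + 4 e - v0, after e^2 <= e; it
   also covers the lower error. *)
have [e [e0 e1 ev ee]] : exists e : R, [/\ 0 < e, e <= 1, e <= v0 & e * (3 * v0 + 12) <= eta].
  exists (Num.min (Num.min 1 v0) (eta / (3 * v0 + 12))); split.
  - by rewrite !lt_min ltr01 v00 divr_gt0.
  - by rewrite !ge_min lexx.
  - by rewrite !ge_min lexx orbT.
  - by rewrite -ler_pdivlMr// !ge_min lexx !orbT.
(* Besides theta h <= 1/4 for the comparison, h / 2 <= e bounds the bias of the Euler chain and h Kc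
   <= e^2 makes the comparison error, divided by e, at most e. *)
have [m [h1 th h2 Kh]] : exists m, let h : R := m.+1%:R^-1 in
    [/\ h <= 1, theta * h <= 1 / 4, h / 2 <= e & h * Kc <= e ^+ 2].
  have [A AE] : exists A, A = 1 + 4 * theta + e^-1 + Kc / e ^+ 2 by eexists.
  have i0 : 0 < e^-1 by rewrite invr_gt0.
  have k0 : 0 <= Kc / e ^+ 2 by rewrite divr_ge0 ?sqr_ge0.
  exists (Num.truncn A) => h.
  have hA : A * h <= 1.
    by rewrite /h ler_pdivrMr ?ltr0n// mul1r ltW// truncnS_gt.
  have h0 : 0 < h by rewrite invr_gt0 ltr0n.
  clearbody h.
  have t1 : 0 <= theta * h by rewrite mulr_ge0 ?(ltW h0) ?(ltW theta0).
  have t2 : 0 <= e^-1 * h by rewrite mulr_ge0 ?(ltW h0) ?(ltW i0).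
  have t3 : 0 <= Kc / e ^+ 2 * h by rewrite mulr_ge0 ?(ltW h0).
  have hA' : h + 4 * (theta * h) + e^-1 * h + Kc / e ^+ 2 * h <= 1.
    by apply: le_trans hA; rewrite AE; lra.
  split; [lra|lra| |].
  - have : e^-1 * h <= 1 by lra.
    by rewrite mulrC ler_pdivrMr//; lra.
  - have : Kc / e ^+ 2 * h <= 1 by lra.
    by rewrite mulrAC ler_pdivrMr ?exprn_gt0//; lra.
have {qv} qv := qv m; have {quartic} [m0 quartic] := quartic m.
move: h1 th h2 Kh qv quartic => /=.
have : 0 < m.+1%:R^-1 :> R by rewrite invr_gt0 ltr0n.
move: (m.+1%:R^-1) => h h0 h1 th h2 Kh qv quartic.
have th0 : 0 < theta * h by rewrite mulr_gt0.
have [a aE] : exists a, a = 1 - theta * h by eexists.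
have a01 : 0 <= a < 1 by rewrite aE; apply/andP; split; lra.
have [Y [Y0 YS]] : exists Y : nat -> R, Y 0%N = 0 /\
    forall k, Y k.+1 = a * Y k + (w (k.+1%:R * h) - w (k%:R * h)).
  by exists (autoregression R a (fun k => w (k%:R * h))).
have Yav : average (fun k => Y k ^+ 2) @ \oo --> h / (1 - a ^+ 2).
  exact: (@average_ar_sqr R (fun k => w (k%:R * h)) Y a h a01 (ltW h0) qv Y0 YS).
have vE : h / (1 - a ^+ 2) = v0 + h / (2 * (2 - theta * h)).
  have -> : 1 - a ^+ 2 = h * theta * (2 - theta * h) by rewrite aE; ring.
  have -> : v0 = 2^-1 / theta by rewrite -tv0 mulrAC divff ?mul1r// gt_eqF.
  by field; apply/and3P; split; apply/eqP; lra.
have hb : 0 <= h / (2 * (2 - theta * h)) <= h / 2.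
  apply/andP; split; first by rewrite divr_ge0//; lra.
  by rewrite ler_pM2l// lef_pV2 ?posrE; lra.
have v2 : h / (2 * (2 - theta * h)) <= v0.
  case/andP: hb => _ hb; apply: (le_trans hb).
  by rewrite -(ler_pM2l theta0) tv0; lra.
set v := h / (1 - a ^+ 2) in Yav vE.
clearbody v; rewrite aE in YS.
have [s [D [sP DP DS]]] := @block_approximation R x w theta h Y theta0 h0 th xc x0 sde Y0 YS.
have Dav : exists N0, forall N, (N0 <= N)%N -> \sum_(k < N) D k <= N%:R * (h * Kc).
  have /average_cvgP/(_ _ ltr01)[N1 _ HN] := Yav.
  exists (maxn (2 ^ m0) N1) => N; rewrite geq_max => /andP[mN N1N].
  have := HN _ N1N => /ler_normlW YN.
  have wN := @block_oscillation_le R w h C m0 h0 C0 wc quartic N s mN sP.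
  apply: (le_trans (DS N)).
  have N0 : 0 <= N%:R :> R by [].
  have Y1 : \sum_(k < N) Y k ^+ 2 <= N%:R * (2 * v0 + 1).
    have : N%:R * v <= N%:R * (2 * v0) by rewrite ler_wpM2l// vE; lra.
    lra.
  have hh : h ^+ 2 <= h by rewrite expr2 ler_piMl ?(ltW h0).
  have Y2 : 160 * (theta * h) ^+ 2 * (\sum_(k < N) Y k ^+ 2) <=
      160 * theta ^+ 2 * h * (N%:R * (2 * v0 + 1)).
    apply: ler_pM => //.
    - by rewrite mulr_ge0 ?sqr_ge0.
    - by apply: sumr_ge0 => k _; exact: sqr_ge0.
    - by rewrite exprMn mulrA ler_wpM2l// mulr_ge0 ?sqr_ge0.
  have -> : N%:R * (h * Kc) = 160 * (N%:R * ((15 + 40 * C) * h)) +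
    160 * theta ^+ 2 * h * (N%:R * (2 * v0 + 1)) by rewrite KcE; ring.
  by rewrite lerD// ler_wpM2l.
have B0 : 0 <= h * Kc by rewrite mulr_ge0// ltW.
have ev' : e <= v by rewrite vE; case/andP: hb; lra.
have e01 : 0 < e <= 1 by rewrite e0.
have := @sampled_average_bounds R x Y D h v (h * Kc) h0 B0 DP Yav Dav Delta Dp Dc Tc e e01 ev'.
have vb : v0 <= v <= v0 + e.
  by case/andP: hb => hb1 hb2; rewrite vE; apply/andP; split; lra.
have Be : h * Kc / e <= e by rewrite ler_pdivrMr// -expr2.
move: vb Be; rewrite -![_ * (h * Kc) / e]mulrA.
move: (h * Kc / e) v {vE Yav Dav ev' B0} => b v /andP[vb1 vb2] be.
apply: filterS => n /andP[L U].
have ee2 : e * e <= e by rewrite ler_piMl// ltW.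
have U1 : (1 + e) ^+ 2 * (v + e) <= (1 + 3 * e) * (v0 + 2 * e).
  by apply: ler_pM; rewrite ?sqr_ge0//; lra.
have L1 : (1 - 2 * e) * (v0 - e) <= (1 - e) ^+ 2 * (v - e).
  apply: (@le_trans _ _ ((1 - e) ^+ 2 * (v0 - e))).
    by rewrite ler_wpM2r ?subr_ge0//; have := sqr_ge0 e; lra.
  by rewrite ler_wpM2l ?sqr_ge0//; lra.
have ev0 : 0 <= e * v0 by rewrite mulr_ge0 ?(ltW e0) ?(ltW v00).
have ee0 : 0 <= e * e by rewrite mulr_ge0 ?(ltW e0).
rewrite ler_distl; move: L U; move: (_ / n%:R) => S L U.
by apply/andP; split; lra.
Qed.

(** * Consistency *)

(** The inverse is continuous off 0, and the point 0, where it takes the value 0, is treated as a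
    separate measurable piece. *)
Lemma measurable_invr (R : realType) :
  measurable_fun [set: R] (fun x : R => x^-1).
Proof.
rewrite -(setUv [set (0 : R)]); apply/measurable_funU => //.
  exact: measurableC.
split; first exact: measurable_fun_set1.
apply: open_continuous_measurable_fun.
  by apply: closed_openC; exact: closed_eq.
by move=> x; rewrite inE => /eqP x0; exact: inv_continuous.
Qed.

(** The events of a deviation at some index k >= n decrease to their upper limit, which lies in the
    null set of non-convergence; continuity from above concludes. *)
Lemma cvg_almost_surely_in_probability (d : measure_display)
    (T : measurableType d) (R : realType) (P : probability T R)
    (Y : nat -> T -> R) (l : R) :
  (forall n, measurable_fun [set: T] (Y n)) ->
  cvg_almost_surely P Y l -> cvg_in_probability P Y l.
Proof.
move=> mY [N [mN N0 YN]] e e0.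
pose F n := [set w | e < `|Y n w - l|].
have mF n : measurable (F n).
  have mYl : measurable_fun [set: T] (fun w => `|Y n w - l|).
    by apply: measurableT_comp => //; exact: measurable_funB.
  have := mYl measurableT _ (measurable_itv `]e, +oo[).
  rewrite setTI; congr measurable.
  by apply/seteqP; split => w /=; rewrite in_itv/= andbT.
have limF : P (lim_sup_set F) = 0%E.
  apply: subset_measure0 mN _ N0.
    by apply: bigcap_measurable => // k _; exact: bigcup_measurable.
  move=> w Fw; apply: YN => /cvgrPdist_le/(_ _ e0)[M _ HM].
  have [k /= Mk] := Fw M I.
  by rewrite /F /= distrC ltNge => /negP; apply; exact: HM.
have Fcvg : P (\bigcup_(k >= n) F k) @[n --> \oo] --> 0%E.
  rewrite -limF; apply: lim_sup_set_cvg => //.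
  apply: (@le_lt_trans _ _ 1%E); last exact: ltry.
  by apply: probability_le1; exact: bigcup_measurable.
apply: (@squeeze_cvge _ _ _ _ (cst 0%E) _ (fun n => P (\bigcup_(k >= n) F k))) => //.
- near=> n; rewrite measure_ge0/=.
  apply: le_measure; rewrite ?inE//; last by move=> w Fw; exists n => /=.
    exact: mF.
  exact: bigcup_measurable.
- exact: cvg_cst.
Unshelve. all: end_near. Qed.

Theorem theorem3p5 (d : measure_display) (Omega : measurableType d)
    (R : realType) (P : probability Omega R) (theta : R)
    (W X : R -> {RV P >-> R}) (Delta : nat -> R)
    (theta_gt0 : 0 < theta)
    (W_bm : standard_brownian_motion W)
    (X_ou : ornstein_uhlenbeck theta W X)
    (Delta_gt0 : forall n : nat, (1 <= n)%N -> 0 < Delta n)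
    (Delta_cvg : Delta n @[n --> \oo] --> (0 : R))
    (T_cvg : n%:R * Delta n @[n --> \oo] --> +oo) :
  cvg_in_probability P (theta_tilde X Delta) theta /\
  ((exists2 eta : R, 1 < eta < 2 &
      n%:R * Delta n `^ eta @[n --> \oo] --> (0 : R)) \/
   (exists2 eta : R, 1 < eta &
      n%:R * Delta n `^ eta @[n --> \oo] --> +oo) ->
   cvg_almost_surely P (theta_tilde X Delta) theta).
Proof.
have as_cvg : cvg_almost_surely P (theta_tilde X Delta) theta.
  have h0 m : 0 < m.+1%:R^-1 :> R by rewrite invr_gt0 ltr0n.
  (* Meshes and lags are countable, so one null set serves them all. *)
  have qv : {ae P, forall w, forall m l, (0 < l)%N ->
      average (fun k => (W ((k + l)%:R * m.+1%:R^-1) w - W (k%:R * m.+1%:R^-1) w) ^+ 2)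
        @ \oo --> (l%:R * m.+1%:R^-1 : R)}.
    apply: ae_foralln => m; apply: ae_foralln => -[|l].
      exact: aeW.
    by have := @ae_quadratic_variation _ _ _ _ _ W_bm _ l.+1 (h0 m) isT; apply: filterS => w.
  have quartic : {ae P, forall w, forall m, exists m0, forall m' j, (m0 <= m')%N ->
      \sum_(k < (2 ^ (m' + j))%N) (W (k.+1%:R * (m.+1%:R^-1 / 2 ^+ j)) w -
        W (k%:R * (m.+1%:R^-1 / 2 ^+ j)) w) ^+ 4
      <= 2 ^+ (m' + j) * (2 ^+ 16 * (m.+1%:R^-1 / 2 ^+ j) ^+ 2) :> R}.
    by apply: ae_foralln => m; exact: ae_dyadic_quartic_variation.
  have Wc := bm_continuous W_bm.
  have Xc := ou_continuous X_ou; have X0 := ou_start X_ou; have sde := ou_sde X_ou.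
  have regular0 : {ae P, forall w, [/\ X 0 w = 0,
      {within `[0, +oo[, continuous (fun t : R => X t w)} &
      {within `[0, +oo[, continuous (fun t : R => W t w)}]}.
    by apply: filterS3 X0 Xc Wc => w.
  have regular : {ae P, forall w, [/\ X 0 w = 0,
      {within `[0, +oo[, continuous (fun t : R => X t w)},
      {within `[0, +oo[, continuous (fun t : R => W t w)} &
      forall t : R, 0 <= t -> X t w = X 0 w +
        \int[lebesgue_measure]_(s in `[0, t]) (- theta * X s w) +
        (W t w - W 0 w)]}.
    by apply: filterS2 regular0 sde => w [? ? ?].
  rewrite /cvg_almost_surely; move: regular qv quartic; apply: filterS3.
  move=> w [x0 xc wc sde'] qv' quartic'.
  have := @cvg_sampled_average R (fun t => X t w) (fun t => W t w) theta (2 ^+ 16)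
    Delta theta_gt0 (exprn_ge0 _ (ler0n _ _)) xc wc x0 sde' qv' quartic'
    Delta_gt0 Delta_cvg T_cvg.
  move=> Scvg.
  rewrite (_ : theta_tilde X Delta ^~ w = fun n =>
    (2 * ((\sum_(1 <= i < n.+1) X (i%:R * Delta n) w ^+ 2) / n%:R))^-1); last first.
    by apply/funext => n; rewrite /theta_tilde div1r mulrAC mulrA.
  rewrite [X in _ --> X](_ : _ = (2 * (2 * theta)^-1)^-1); last by field; rewrite gt_eqF.
  (* Twice the average of squares tends to 1 / theta, a nonzero value at which inversion is
     continuous. *)
  apply: cvgV; last exact: cvgMl_tmp.
  by rewrite mulf_neq0// invr_neq0// mulf_neq0// gt_eqF.
split=> [|_]; last exact: as_cvg.
apply: cvg_almost_surely_in_probability as_cvg => n.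
rewrite /theta_tilde; under eq_fun do rewrite div1r.
apply: (measurableT_comp (measurable_invr R)).
apply: measurable_funM => //; apply: measurable_sum => i.
by apply: measurable_funX; exact: measurable_funPT.
Qed.
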